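(* Let $T\in\mathcal{B}(l^2(\mathbb{N}))$ be an invertible normal operator with $\sigma(T)=\omega\cup\Psi$ and $\omega=\{\lambda_i\}_{i=1}^N$, where the $\lambda_i$ are isolated eigenvalues with (possibly infinite) multiplicity $m_i$ satisfying $|\lambda_1|>\dots>|\lambda_N|$. Suppose further that $\sup\{|\theta|:\theta\in\Psi\}<|\lambda_N|$, and let $\{e_j\}_{j\in\mathbb{N}}$ be the canonical orthonormal basis. Let $\{Q_n\}_{n\in\mathbb{N}}$ and $\{R_n\}_{n\in\mathbb{N}}$ be $Q$- and $R$-sequences of $T$ with respect to $\{e_j\}_{j\in\mathbb{N}}$. Let $\{\hat e_j\}_{j=1}^M\subset\{e_j\}_{j\in\mathbb{N}}$, where $M=m_1+\dots+m_N$, be the subset defined in the context, and let $\{\hat q_j\}_{j=1}^M\subset\mathrm{ran}\,\chi_\omega(T)$ be the associated collection of orthonormal eigenvectors of $T$ described in the context; i.e. $\mathrm{span}\{Q_k\hat e_j\}\to\mathrm{span}\{\hat q_j\}$ as $k\to\infty$ for each $j$, and if $e_j\notin\{\hat e_l\}_{l=1}^M$, then $\chi_\omega(T)Q_ke_j\to0$ as $k\to\infty$. Then: (i) Every subsequence of $\{Q_n^*TQ_n\}_{n\in\mathbb{N}}$ has a convergent subsequence $\{Q_{n_k}^*TQ_{n_k}\}_{k\in\mathbb{N}}$ such that, in the weak operator topology, $$Q_{n_k}^*TQ_{n_k}\longrightarrow\Big(\bigoplus_{j=1}^M\langle T\hat q_j,\hat q_j\rangle\,\hat e_j\otimes\hat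 e_j\Big)\bigoplus\sum_{j\in\Theta}\xi_j\otimes e_j,\qquad k\to\infty,$$ where $\Theta=\{j:e_j\notin\{\hat e_l\}_{l=1}^M\}$, $\xi_j\in\overline{\mathrm{span}\{e_i\}_{i\in\Theta}}$, and only $\sum_{j\in\Theta}\xi_j\otimes e_j$ depends on the choice of subsequence. Furthermore, if $T$ has only finitely many non-zero entries in each column, then weak operator convergence can be replaced by strong operator convergence. (ii) We have the following convergence of sections in the strong operator topology: $$\widehat P_MQ_n^*TQ_n\widehat P_M\longrightarrow\bigoplus_{j=1}^M\langle T\hat q_j,\hat q_j\rangle\,\hat e_j\otimes\hat e_j,\qquad n\to\infty,$$ where $\widehat P_M$ denotes the orthogonal projection onto $\overline{\mathrm{span}\{\hat e_j\}_{j=1}^M}$. Furthermore, if we define $\rho=\sup\{|z|:z\in\Psi\}$ and $r=\max\{|\lambda_2/\lambda_1|,\dots,|\lambda_N/\lambda_{N-1}|,\rho/|\lambda_N|\}$, then $r<1$ and for any fixed $x\in\mathrm{span}\{\hat e_j\}_{j=1}^M$ we have the rate of convergence $$\Big\|\widehat P_MQ_n^*TQ_n\widehat P_Mx-\Big(\bigoplus_{j=1}^M\langle T\hat q_j,\hat q_j\rangle\,\hat e_j\otimes\hat e_j\Big)x\Big\|=O(r^n),\qquad n\to\infty.$$ If $M$ is finite, then we can write (after possibly re-ordering) $$\bigoplus_{j=1}^M\langle T\hat q_j,\hat q_j\rangle\,\hat e_j\otimes\hat e_j=\bigoplus_{k=1}^N\Big(\lambda_k\bigoplus_{j=1+\sum_{l<k}m_l}^{\sum_{l\le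 k}m_l}\hat e_j\otimes\hat e_j\Big),$$ and in part (ii) we have the rate of convergence $$\Big\|\widehat P_MQ_n^*TQ_n\widehat P_M-\bigoplus_{j=1}^M\langle T\hat q_j,\hat q_j\rangle\,\hat e_j\otimes\hat e_j\Big\|=O(r^n),\qquad n\to\infty.$$ If $\{\chi_\omega(T)e_l\}_{l=1}^M$ are linearly independent, then we can take $\hat e_j=e_j$.
   Context: Inner products are linear in the first argument; $T$ is identified with the infinite matrix with entries $t_{ij}=\langle Te_j,e_i\rangle$. $\mathcal{B}(l^2(\mathbb{N}))$ is the set of bounded operators on $l^2(\mathbb{N})$ and $\sigma(T)$ is the spectrum of $T$. For $u,v\in l^2(\mathbb{N})$, $u\otimes v$ denotes the rank-one operator $x\mapsto\langle x,v\rangle u$. $\chi_S(T)$ is the spectral projection (indicator function of the set $S$ applied to the normal operator $T$ via the functional calculus), and $\mathrm{ran}$ denotes the range. $Q$- and $R$-sequences (infinite-dimensional QR algorithm): an operator $R$ is upper triangular if $\langle Re_j,e_i\rangle=0$ for $i>j$. For invertible $T$, put $T_0=T$ and recursively take a QR decomposition $T_{m-1}=Q^{(m)}R^{(m)}$ ($Q^{(m)}$ unitary, $R^{(m)}$ upper triangular) and set $T_m=R^{(m)}Q^{(m)}$. Put $Q_n=Q^{(1)}Q^{(2)}\cdots Q^{(n)}$ and $R_n=R^{(n)}\cdots R^{(1)}$. Then $\{Q_n\}$ and $\{R_n\}$ are called a $Q$-sequence and an $R$-sequence of $T$; one has $T_n=Q_n^*TQ_n$ and $T^n=Q_nR_n$.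 The subset $\{\hat e_j\}$: $M=m_1+\dots+m_N\in\mathbb{N}\cup\{\infty\}$ is the dimension of $\mathrm{ran}\,\chi_\omega(T)$. Let $K\in\mathbb{N}\cup\{\infty\}$ be minimal with $\dim(\mathrm{span}\{\chi_\omega(T)e_j\}_{j=1}^K)=M$. Put $\Lambda_\omega=\{e_j:\chi_\omega(T)e_j\ne0,\ j\le K\}$ and $\tilde\Lambda_\omega=\{e_j\in\Lambda_\omega:\chi_\omega(T)e_j\in\mathrm{span}\{\chi_\omega(T)e_i\}_{i=1}^{j-1}\}$. Then $\{\hat e_j\}_{j=1}^M=\Lambda_\omega\setminus\tilde\Lambda_\omega$, enumerated so that $\hat e_j=e_{p_j}$ with $p_j$ increasing. The eigenvectors $\{\hat q_j\}$: it is already known, and is part of the set-up rather than of the conclusion, that under the hypotheses on $T$ there is a collection $\{\hat q_j\}_{j=1}^M\subset\mathrm{ran}\,\chi_\omega(T)$ of orthonormal eigenvectors of $T$ with $\mathrm{span}\{Q_k\hat e_j\}\to\mathrm{span}\{\hat q_j\}$ as $k\to\infty$ for each $j$, and that $\chi_\omega(T)Q_ke_j\to0$ as $k\to\infty$ whenever $e_j\notin\{\hat e_l\}_{l=1}^M$. The vectors $\hat q_j$ in the claim are these. Convergence of closed subspaces $M_k\to M'$ means $\hat\delta(M_k,M')\to0$, where $\hat\delta(M',N')=\|E-F\|$ with $E,F$ the orthogonal projections onto $M',N'$. *)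

(* Defs.v *)
From HB Require Import structures.
From mathcomp Require Import all_boot all_order all_algebra perm complex.
From mathcomp Require Import all_classical all_reals all_analysis.

Set Implicit Arguments.
Unset Strict Implicit.
Unset Printing Implicit Defensive.

Import Order.TTheory GRing.Theory Num.Theory numFieldNormedType.Exports.
Import Normc.

Local Open Scope classical_set_scope.
Local Open Scope complex_scope.
Local Open Scope ring_scope.

(* As for the other number fields in numFieldNormedType: the topology of R[i]
   is that of the modulus. *)
HB.instance Definition _ (R : realType) := NormedModule.copy R[i] R[i]^o.

Definition sqsum (R : realType) (x : nat -> R[i]) : nat -> R :=
  series (fun n => normc (x n) ^+ 2).

Definition l2_pred (R : realType) : {pred nat -> R[i]} :=
  fun x => `[< cvgn (sqsum x) >].

Section l2_closed.
Variable R : realType.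
Implicit Types (x y : nat -> R[i]) (n : nat).

Lemma normc_ge0 (z : R[i]) : 0 <= normc z.
Proof. by case: z => a b; exact: sqrtr_ge0. Qed.

Lemma le_normcD (z w : R[i]) : normc (z + w) <= normc z + normc w.
Proof.
have : `|z + w| <= `|z| + `|w| := ler_normD z w.
by rewrite -[`|z + w|]/((normc (z + w))%:C) -[`|z|]/((normc z)%:C)
  -[`|w|]/((normc w)%:C) -rmorphD /= lecR.
Qed.

Lemma sqsumS x n : sqsum x n.+1 = sqsum x n + normc (x n) ^+ 2.
Proof. by rewrite /sqsum /series /= big_nat_recr. Qed.

Lemma sqsum0 x : sqsum x 0 = 0.
Proof. by rewrite /sqsum /series /= big_geq. Qed.

Lemma sqsum_ge0 x n : 0 <= sqsum x n.
Proof. by apply: sumr_ge0 => i _; exact: sqr_ge0. Qed.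

Lemma sqsum_nd x : {homo sqsum x : m n / (m <= n)%N >-> m <= n}.
Proof.
by apply/nondecreasing_seqP => n; rewrite sqsumS lerDl sqr_ge0.
Qed.

Lemma sqsum_cvg_bounded x B : (forall n, sqsum x n <= B) -> cvgn (sqsum x).
Proof.
move=> xB; apply: nondecreasing_is_cvgn; first exact: sqsum_nd.
by exists B => _ [n _ <-].
Qed.

Lemma sqsum_le_lim x n : cvgn (sqsum x) -> sqsum x n <= limn (sqsum x).
Proof. by move=> cx; apply: nondecreasing_cvgn_le => //; exact: sqsum_nd. Qed.

Lemma sqsumD x y n :
  Num.sqrt (sqsum (x + y) n) <= Num.sqrt (sqsum x n) + Num.sqrt (sqsum y n).
Proof.
elim: n => [|n IH]; first by rewrite !sqsum0 sqrtr0 addr0.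
set a := Num.sqrt (sqsum x n) in IH; set b := Num.sqrt (sqsum y n) in IH.
have sq (u : nat -> R[i]) :
    sqsum u n.+1 = Num.sqrt (sqsum u n) ^+ 2 + normc (u n) ^+ 2.
  by rewrite sqsumS sqr_sqrtr ?sqsum_ge0.
have := le_normcD (a +i* normc (x n)) (b +i* normc (y n)).
rewrite /= !sq -/a -/b; apply: le_trans.
by rewrite ler_wsqrtr // lerD // lerXn2r ?nnegrE ?addr_ge0 ?sqrtr_ge0
  ?normc_ge0 // le_normcD.
Qed.

Lemma sqsumZ (a : R[i]) x n : sqsum (a *: x) n = normc a ^+ 2 * sqsum x n.
Proof.
rewrite /sqsum /series /= mulr_sumr; apply: eq_bigr => i _.
by rewrite -exprMn -normcM.
Qed.

Lemma l2_submod_closed : submod_closed (@l2_pred R).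
Proof.
split=> [|a x y /asboolP cx /asboolP cy]; apply/asboolP.
  apply: (@sqsum_cvg_bounded _ 0) => n.
  by rewrite /sqsum /series /= big1 // => i _; rewrite -[LHS]/(normc 0 ^+ 2) normc0 expr0n.
pose A := normc a * Num.sqrt (limn (sqsum x)) + Num.sqrt (limn (sqsum y)).
have A0 : 0 <= A by rewrite addr_ge0 ?mulr_ge0 ?sqrtr_ge0 ?normc_ge0.
apply: (@sqsum_cvg_bounded _ (A ^+ 2)) => n.
rewrite -[leLHS]sqr_sqrtr ?sqsum_ge0 // lerXn2r ?nnegrE ?sqrtr_ge0 //.
apply: le_trans (sqsumD _ _ _) _; rewrite lerD //; last first.
  by rewrite ler_wsqrtr // sqsum_le_lim.
rewrite sqsumZ sqrtrM ?sqr_ge0 // sqrtr_sqr ger0_norm ?normc_ge0 //.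
by rewrite ler_wpM2l ?normc_ge0 // ler_wsqrtr // sqsum_le_lim.
Qed.

End l2_closed.

HB.instance Definition _ (R : realType) :=
  GRing.isSubmodClosed.Build _ _ (@l2_pred R) (@l2_submod_closed R).

Record l2 (R : realType) := L2 {
  l2_seq :> nat -> R[i] ;
  l2_seqP : l2_seq \in @l2_pred R }.

HB.instance Definition _ (R : realType) := [isSub for @l2_seq R].
HB.instance Definition _ (R : realType) := [Choice of l2 R by <:].
HB.instance Definition _ (R : realType) :=
  [SubChoice_isSubLmodule of l2 R by <:].

(* The normedModType norm `|x| declared below is (l2norm x)%:C : R[i]. *)
Definition l2norm (R : realType) (x : l2 R) : R :=
  Num.sqrt (limn (sqsum x)).

Section l2_normed.
Variable R : realType.
Implicit Types x y : l2 R.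

Lemma l2_cvg x : cvgn (sqsum x).
Proof. by have /asboolP := l2_seqP x. Qed.
Arguments l2_cvg : clear implicits.

Lemma sqsum_lim_ge0 x : 0 <= limn (sqsum x).
Proof.
have := sqsum_le_lim 0 (l2_cvg x); apply: le_trans; exact: sqsum_ge0.
Qed.

Lemma l2normD x y : l2norm (x + y) <= l2norm x + l2norm y.
Proof.
have A0 : 0 <= l2norm x + l2norm y by rewrite addr_ge0 ?sqrtr_ge0.
rewrite -[leRHS]ger0_norm // -sqrtr_sqr ler_wsqrtr //.
apply: limr_le; first exact: l2_cvg.
apply: nearW => n.
rewrite -[leLHS]sqr_sqrtr ?sqsum_ge0 // lerXn2r ?nnegrE ?sqrtr_ge0 //.
apply: le_trans (sqsumD _ _ _) _.
by rewrite lerD // ler_wsqrtr // sqsum_le_lim //; exact: l2_cvg.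
Qed.

Lemma l2normZ (a : R[i]) x : l2norm (a *: x) = normc a * l2norm x.
Proof.
rewrite /l2norm (_ : sqsum _ = (fun n => normc a ^+ 2 * sqsum x n)); last first.
  by apply/funext => n; exact: sqsumZ.
rewrite (cvg_lim _ (cvgM (cvg_cst (normc a ^+ 2)) (l2_cvg x))) //.
by rewrite sqrtrM ?sqr_ge0 // sqrtr_sqr ger0_norm ?normc_ge0.
Qed.

Lemma l2norm_eq0 x : l2norm x = 0 -> x = 0.
Proof.
move=> /eqP; rewrite sqrtr_eq0 => x0.
apply/val_inj/funext => n; apply: eq0_normc; apply/eqP.
rewrite -sqrf_eq0 eq_le sqr_ge0 andbT; apply: le_trans x0; apply: le_trans (sqsum_le_lim n.+1 (l2_cvg x)).
by rewrite sqsumS lerDr sqsum_ge0.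
Qed.

Let l2normDC x y : (l2norm (x + y))%:C <= (l2norm x)%:C + (l2norm y)%:C.
Proof. by rewrite -rmorphD /= lecR l2normD. Qed.

Let l2normZC (a : R[i]) x : (l2norm (a *: x))%:C = `|a| * (l2norm x)%:C.
Proof. by rewrite l2normZ rmorphM. Qed.

Let l2normC_eq0 x : (l2norm x)%:C = 0 -> x = 0.
Proof. by case=> /l2norm_eq0. Qed.

HB.instance Definition _ :=
  Lmodule_isNormed.Build R[i] (l2 R) l2normDC l2normZC l2normC_eq0.

Lemma basis_in_l2 (j : nat) :
  (fun n => (n == j)%:R : R[i]) \in @l2_pred R.
Proof.
apply/asboolP; apply: (@sqsum_cvg_bounded _ _ 1) => n.
suff -> : sqsum (fun n => (n == j)%:R : R[i]) n = (j < n)%:R.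
  by case: (j < n)%N.
elim: n => [|n IH]; first by rewrite sqsum0.
rewrite sqsumS IH ltnS; have [->|nj] := eqVneq n j.
  by rewrite ltnn leqnn normc1 expr1n add0r.
by rewrite normc0 expr0n addr0 [in RHS]leq_eqVlt eq_sym (negPf nj).
Qed.

End l2_normed.

Definition l2_basis (R : realType) (j : nat) : l2 R := L2 (basis_in_l2 R j).

Definition inner (R : realType) (x y : l2 R) : R[i] :=
  limn (series (fun n => x n * (y n)^*)).

Notation l2op R := {linear l2 R -> l2 R}.

Section operators.
Variable R : realType.
Local Notation C := (R[i]).
Local Notation H := (l2 R).
Local Notation e := (@l2_basis R).
Implicit Types (A T Q : l2op R) (V W : set H).

Definition bounded_op A : Prop :=
  exists c : R, forall x, l2norm (A x) <= c * l2norm x.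

Definition opnorm (A : H -> H) : R :=
  sup [set l2norm (A x) | x in [set x | l2norm x <= 1]].

(* The adjoint; the default value 0 is never used when A is bounded. *)
Definition adj A : l2op R :=
  xget (GRing.null_fun H : l2op R)
    [set B : l2op R | forall x y, inner (A x) y = inner x (B y)].

Definition normal_op A : Prop := forall x, adj A (A x) = A (adj A x).

Definition unitary_op Q : Prop :=
  [/\ bounded_op Q, forall x, adj Q (Q x) = x & forall x, Q (adj Q x) = x].

Definition invertible_op (A : H -> H) : Prop :=
  exists B : l2op R, [/\ bounded_op B, cancel A B & cancel B A].

Definition spectrum T : set C :=
  [set z | ~ invertible_op (fun x => T x - z *: x)].

Definition eigenspace_op T (z : C) : set H := [set x | T x = z *: x].

Definition eigenvalue_op T (z : C) : Prop :=
  exists2 x, x != 0 & T x = z *: x.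

Definition rank_one (u v : H) : H -> H := fun x => inner x v *: u.

(* A x is the norm-convergent sum of the F j x over j in J, for every x. *)
Definition is_op_sum (J : set nat) (F : nat -> H -> H) A : Prop :=
  forall x, \sum_(j < n | (j : nat) \in J) F j x @[n --> \oo] --> A x.

Definition wot_cvg (A : nat -> H -> H) (B : H -> H) : Prop :=
  forall x y, inner (A n x) y @[n --> \oo] --> inner (B x) y.

Definition sot_cvg (A : nat -> H -> H) (B : H -> H) : Prop :=
  forall x, A n x @[n --> \oo] --> B x.

Definition entry T (i j : nat) : C := inner (T (e j)) (e i).

Definition column_finite T : Prop :=
  forall j, finite_set [set i | entry T i j != 0].

Definition upper_triangular T : Prop :=
  forall i j : nat, (j < i)%N -> entry T i j = 0.

Definition lspan (S : set H) : set H :=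
  [set x | exists n (c : 'I_n -> C) (v : 'I_n -> H),
    (forall i, S (v i)) /\ x = \sum_(i < n) c i *: v i].

(* The orthogonal projection onto V; the default value 0 is never used when
   V is a closed subspace. *)
Definition orthoproj V : l2op R :=
  xget (GRing.null_fun H : l2op R)
    [set P : l2op R | forall x, V (P x) /\
      forall y, V y -> inner (x - P x) y = 0].

Definition gap V W : R := opnorm (fun x => orthoproj V x - orthoproj W x).

Definition lin_indep (J : set nat) (v : nat -> H) : Prop :=
  forall n (c : nat -> C),
    \sum_(j < n | (j : nat) \in J) c j *: v j = 0 ->
    forall j, (j < n)%N -> J j -> c j = 0.

(* N u {oo}, with None standing for oo *)
Definition enat := option nat.

Definition enat_add (a b : enat) : enat :=
  if a is Some m then (if b is Some n then Some (m + n)%N else None) else None.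

Definition enat_le (a b : enat) : bool :=
  if b is Some n then (if a is Some m then (m <= n)%N else false) else true.

(* {0, ..., a - 1}, or the whole of nat if a = oo *)
Definition below (a : enat) : set nat :=
  [set j | if a is Some m then (j < m)%N else true].

Definition has_dim V (a : enat) : Prop :=
  match a with
  | Some n => exists v : nat -> H,
      lin_indep (below a) v /\ V = lspan (v @` below a)
  | None => forall n, exists v : nat -> H,
      lin_indep (below (Some n)) v /\ (v @` below (Some n)) `<=` V
  end.

Definition Borel (f : C -> C) : Prop :=
  measurable_fun [set: g_sigma_algebraType (@open C)]
    (f : g_sigma_algebraType (@open C) -> g_sigma_algebraType (@open C)).

(* f is a bounded Borel function on the spectrum of T (extended to C). *)
Definition calculus_fun T (f : C -> C) : Prop :=
  Borel f /\ exists c : R, forall z, spectrum T z -> normc (f z) <= c.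

(* Phi f = f(T): the bounded Borel functional calculus is the only map with
   these properties. *)
Record functional_calculus T (Phi : (C -> C) -> l2op R) : Prop := {
  calc_one : forall x, Phi (fun=> 1) x = x ;
  calc_id : forall x, Phi id x = T x ;
  calc_add : forall f g, calculus_fun T f -> calculus_fun T g ->
    forall x, Phi (fun z => f z + g z) x = Phi f x + Phi g x ;
  calc_scale : forall (a : C) f, calculus_fun T f ->
    forall x, Phi (fun z => a * f z) x = a *: Phi f x ;
  calc_mul : forall f g, calculus_fun T f -> calculus_fun T g ->
    forall x, Phi (fun z => f z * g z) x = Phi f (Phi g x) ;
  calc_conj : forall f, calculus_fun T f ->
    forall x y, inner (Phi f x) y = inner x (Phi (fun z => (f z)^*) y) ;
  calc_norm : forall f (c : R), calculus_fun T f ->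
    (forall z, spectrum T z -> normc (f z) <= c) ->
    forall x, l2norm (Phi f x) <= c * l2norm x ;
  calc_lim : forall (f : nat -> C -> C) (g : C -> C) (c : R),
    (forall n, calculus_fun T (f n)) -> calculus_fun T g ->
    (forall n z, spectrum T z -> normc (f n z) <= c) ->
    (forall z, spectrum T z -> f n z @[n --> \oo] --> g z) ->
    forall x, Phi (f n) x @[n --> \oo] --> Phi g x }.

(* P = chi_S(T) *)
Definition is_spectral_proj T (S : set C) (P : l2op R) : Prop :=
  exists Phi, functional_calculus T Phi /\ P = Phi (\1_S).

(* With the factors indexed from 0: Qf n and Rf n are Q^(n+1) and R^(n+1). *)
Definition QR_sequences T (Q Rs : nat -> l2op R) : Prop :=
  exists Tn Qf Rf : nat -> l2op R,
    [/\ Tn 0 =1 T,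
        forall n, [/\ unitary_op (Qf n), bounded_op (Rf n),
          upper_triangular (Rf n), Tn n =1 Qf n \o Rf n &
          Tn n.+1 =1 Rf n \o Qf n],
        Q 0 =1 id /\ (forall n, Q n.+1 =1 Q n \o Qf n) &
        Rs 0 =1 id /\ (forall n, Rs n.+1 =1 Rf n \o Rs n)].

(* K is minimal in N u {oo} with dim span {P e_j}_{j < K} = M. *)
Definition is_cutoff (P : l2op R) (M K : enat) : Prop :=
  let good L := has_dim (lspan [set P (e j) | j in below L]) M in
  good K /\ forall L, good L -> enat_le K L.

Definition Lambda (P : l2op R) (K : enat) : set nat :=
  [set j | below K j /\ P (e j) != 0].

Definition Lambda_dep (P : l2op R) (K : enat) : set nat :=
  [set j | Lambda P K j /\
    lspan [set P (e i) | i in [set i | (i < j)%N]] (P (e j))].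

(* Basis indices start at 0, and j |-> p j enumerates the indices of the
   e^_j = e_(p j) for j < M; the other values of p are irrelevant. *)
Definition hat_enum (P : l2op R) (M : enat) (p : nat -> nat) : Prop :=
  exists K, [/\ is_cutoff P M K,
    forall i j, below M j -> (i < j)%N -> (p i < p j)%N &
    p @` below M = Lambda P K `\` Lambda_dep P K].

(* The q j with j < M are the q^_j; the other values of q are irrelevant. *)
Definition hat_eigenvectors T (P : l2op R) (Q : nat -> l2op R) (M : enat)
    (p : nat -> nat) (q : nat -> H) : Prop :=
  [/\ forall j, below M j -> range P (q j),
      forall i j, below M i -> below M j -> inner (q i) (q j) = (i == j)%:R,
      forall j, below M j -> exists z : C, T (q j) = z *: q j,
      forall j, below M j ->
        gap (lspan [set Q k (e (p j))]) (lspan [set q j]) @[k --> \oo]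
          --> (0 : R) &
      forall j, ~ (p @` below M) j -> P (Q k (e j)) @[k --> \oo] --> (0 : H)].

End operators.

Arguments below : simpl never.

(* Main.v *)
(* The flag of the basis is pushed forward by T^n = Q_n R_n, with R_n upper
   triangular and invertible, so Q_n e_j is the unit vector of
   T^n span(e_0, ..., e_j) orthogonal to T^n span(e_0, ..., e_(j-1)).
   Gaussian elimination with respect to the spectral projections E_0, ...,
   E_(N-1) replaces (e_i) by a basis (w_i) of the same flag such that E_l w_i = 0
   for l below a level k(i) <= N and such that the leading components
   g_i = E_(k(i)) w_i with k(i) < N are orthonormal.  By the spectral gaps,
   lam_(k(i))^(-n) T^n w_i = g_i + O(r^n), while the w_i of level N stay orthogonal
   to ran chi_omega(T); orthogonality of Q_n e_j to the earlier T^n w_i then forces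
   Q_n e_j = a_n g_j + O(r^n) whenever k(j) < N, which holds for every e^_j.  Hence
   the columns and rows of Q_n^* T Q_n indexed by the e^_j converge to those of a
   diagonal operator, with rate r^n for the columns; the remaining block has weak
   limit points by compactness.  When T is column finite, the j-th column of
   Q_n^* T Q_n = R_n T R_n^(-1) stays in a fixed finite-dimensional space, so weak
   convergence is strong. *)
Require Import Defs.
From HB Require Import structures.
From mathcomp Require Import all_boot all_order all_algebra perm complex.
From mathcomp Require Import all_classical all_reals all_analysis.
From mathcomp Require Import ring lra.

Set Implicit Arguments.
Unset Strict Implicit.
Unset Printing Implicit Defensive.

Import Order.TTheory GRing.Theory Num.Theory numFieldNormedType.Exports.
Import Normc.

Local Open Scope classical_set_scope.
Local Open Scope complex_scope.
Local Open Scope ring_scope.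

(** * Convergence in C and in l2, inner product *)

(** The limit of a column only knows the level of its index, whereas the theorem speaks of the q^_j.
    Three bridges connect the two. An index j of level N has P e_j in the span of the earlier P e_i,
    so it is not the index of an e^_l; thus every e^_j comes with an eigenvalue lam_(k(j)). The line
    of Q_n e^_j approaches that of q^_j while Q_n^* T Q_n e^_j approaches lam_(k(j)) e^_j, so q^_j
    has this very eigenvalue. Finally, the elimination does not tell how often a level occurs; for
    finite M the orthonormal q^_j bound the count at level k by m_k, and as the counts and the m_k
    both sum to M, the bounds are equalities.

    The coefficient a_n of g_j need not converge. It drops out of the columns because T - lam_(k(j))
    annihilates g_j, and out of the rows because E_(k(j)) is self-adjoint and commutes with T. The
    constants in O(r^n) depend on j, so a rate in operator norm is obtained by adding finitely many
    of them, for finite M. *)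

Lemma norm_normc (R : realType) (z : R[i]) : `|z| = (normc z)%:C.
Proof. by []. Qed.

Lemma normc_opp (R : realType) (z : R[i]) : normc (- z) = normc z.
Proof. by apply: (@complexI R); rewrite -!norm_normc normrN. Qed.

Lemma normc_distC (R : realType) (z w : R[i]) : normc (z - w) = normc (w - z).
Proof. by rewrite -normc_opp opprB. Qed.

Lemma normc_conj (R : realType) (z : R[i]) : normc z^* = normc z.
Proof. by apply: (@complexI R); rewrite -!norm_normc norm_conjC. Qed.

Lemma normc_real (R : realType) (x : R) : normc x%:C = `|x|.
Proof. by rewrite /= expr0n addr0 sqrtr_sqr. Qed.

Lemma normcX (R : realType) (z : R[i]) n : normc (z ^+ n) = normc z ^+ n.
Proof. by elim: n => [|n IH]; rewrite ?normc1 // !exprS normcM IH. Qed.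

Lemma normc_eq0 (R : realType) (z : R[i]) : (normc z == 0) = (z == 0).
Proof.
by apply/eqP/eqP => [/eq0_normc|->] //; exact: normc0.
Qed.

Lemma mul_conj_normc (R : realType) (z : R[i]) : z * z^* = (normc z ^+ 2)%:C.
Proof. by rewrite -normCK norm_normc rmorphXn. Qed.

Lemma normc_sum (R : realType) (I : Type) (s : seq I) (Pr : pred I)
    (F : I -> R[i]) :
  normc (\sum_(i <- s | Pr i) F i) <= \sum_(i <- s | Pr i) normc (F i).
Proof.
elim/big_ind2 : _ => [|x1 x2 y1 y2 h1 h2|//]; first by rewrite normc0.
by apply: le_trans (Defs.le_normcD _ _) _; exact: lerD.
Qed.

Lemma cvg_normcP (R : realType) (T : Type) (F : set_system T) {FF : Filter F}
    (u : T -> R[i]) (l : R[i]) :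
  u x @[x --> F] --> l <-> normc (l - u x) @[x --> F] --> (0 : R).
Proof.
split=> [/cvgrPdist_lt h|/cvgrPdist_lt h].
  apply/cvgrPdist_lt => eps e0.
  have := h eps%:C; rewrite ltcR => /(_ e0); apply: filterS => x.
  by rewrite norm_normc ltcR sub0r normrN ger0_norm // Defs.normc_ge0.
(* The radius is a complex number here; [0 < a +i* b] forces [b = 0], which reduces it to a real
   one. *)
apply/cvgrPdist_lt => -[a b]; rewrite ltcE /= => /andP[/eqP -> a0].
have := h a a0; apply: filterS => x.
by rewrite norm_normc complexr0 ltcR sub0r normrN ger0_norm // Defs.normc_ge0.
Qed.

Lemma norm_l2norm (R : realType) (x : l2 R) : `|x| = (l2norm x)%:C.
Proof. by []. Qed.

Lemma cvg_l2P (R : realType) (T : Type) (F : set_system T) {FF : Filter F}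
    (u : T -> l2 R) (l : l2 R) :
  u x @[x --> F] --> l <-> l2norm (l - u x) @[x --> F] --> (0 : R).
Proof.
have l20 (y : l2 R) : 0 <= l2norm y by exact: sqrtr_ge0.
split=> [/cvgrPdist_lt h|/cvgrPdist_lt h].
  apply/cvgrPdist_lt => eps e0.
  have := h eps%:C; rewrite ltcR => /(_ e0); apply: filterS => x.
  by rewrite norm_l2norm ltcR sub0r normrN ger0_norm.
apply/cvgrPdist_lt => -[a b]; rewrite ltcE /= => /andP[/eqP -> a0].
have := h a a0; apply: filterS => x.
by rewrite norm_l2norm complexr0 ltcR sub0r normrN ger0_norm.
Qed.

Lemma cvg_complexP (R : realType) (T : Type) (F : set_system T) {FF : Filter F}
    (u : T -> R[i]) (a b : R) :
  complex.Re (u x) @[x --> F] --> a -> complex.Im (u x) @[x --> F] --> b ->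
  u x @[x --> F] --> a +i* b.
Proof.
move=> /cvgrPdist_lt ha /cvgrPdist_lt hb; apply/cvg_normcP/cvgrPdist_lt => e e0.
have e2 : 0 < e / 2 by rewrite divr_gt0.
apply: filterS2 (ha _ e2) (hb _ e2) => x.
case: (u x) => c d /= hc hd.
rewrite sub0r normrN ger0_norm ?sqrtr_ge0 //.
have : normc ((a - c) +i* (b - d)) <= `|a - c| + `|b - d|.
  have -> : (a - c) +i* (b - d) = (a - c)%:C + 'i * (b - d)%:C.
    by rewrite [LHS]complexE.
  apply: le_trans (Defs.le_normcD _ _) _; rewrite normcM !normc_real.
  by rewrite [normc 'i]/= expr0n expr1n add0r sqrtr1 mul1r.
by move/le_lt_trans; apply; rewrite [e]splitr ltrD.
Qed.

Lemma normc_ge_Re (R : realType) (z : R[i]) : `|complex.Re z| <= normc z.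
Proof.
by case: z => a b /=; rewrite -sqrtr_sqr ler_wsqrtr // lerDl sqr_ge0.
Qed.

Lemma normc_ge_Im (R : realType) (z : R[i]) : `|complex.Im z| <= normc z.
Proof.
by case: z => a b /=; rewrite -sqrtr_sqr ler_wsqrtr // lerDr sqr_ge0.
Qed.

(** Real and imaginary parts are absolutely convergent real series, so the completeness of [R]
    suffices. *)
Lemma series_normc_cvg (R : realType) (u : nat -> R[i]) (B : R) :
  (forall n, series (fun k => normc (u k)) n <= B) -> cvgn (series u).
Proof.
move=> hB.
have cvgf (f : R[i] -> R) : (forall z, `|f z| <= normc z) ->
    cvgn (series (fun k => f (u k))).
  move=> fle; apply: normed_cvg; apply: nondecreasing_is_cvgn.
    by apply: nondecreasing_series => n _ _; exact: normr_ge0.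
  exists B => _ [n _ <-]; apply: le_trans (hB n).
  by rewrite /series /=; apply: ler_sum => i _; exact: fle.
have /cvg_ex[a ha] := cvgf _ (@normc_ge_Re R).
have /cvg_ex[b hb] := cvgf _ (@normc_ge_Im R).
apply/cvg_ex; exists (a +i* b); apply: cvg_complexP.
- apply: cvg_trans ha; apply: near_eq_cvg; apply: nearW => n.
  by rewrite /series /=; elim/big_ind2 : _ => // [[? ?] ? [? ?] ?] /= <- <-.
- apply: cvg_trans hb; apply: near_eq_cvg; apply: nearW => n.
  by rewrite /series /=; elim/big_ind2 : _ => // [[? ?] ? [? ?] ?] /= <- <-.
Qed.

Section inner_product.
Variable R : realType.
Local Notation C := (R[i]).
Local Notation H := (l2 R).
Local Notation e := (@l2_basis R).
Implicit Types (x y z : H) (a b : C).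

Lemma sqsumE (f : nat -> C) n : sqsum f n = \sum_(i < n) normc (f i) ^+ 2.
Proof. by rewrite /sqsum /series /= big_mkord. Qed.

Lemma l2norm_ge0 x : 0 <= l2norm x. Proof. exact: sqrtr_ge0. Qed.

Lemma l2norm_sqr x : l2norm x ^+ 2 = limn (sqsum x).
Proof. by rewrite sqr_sqrtr // sqsum_lim_ge0. Qed.

Lemma sqsum_le_l2norm x n : sqsum x n <= l2norm x ^+ 2.
Proof. by rewrite l2norm_sqr sqsum_le_lim //; exact: l2_cvg. Qed.

Lemma l2norm_le x (B : R) :
  0 <= B -> (forall n, sqsum x n <= B ^+ 2) -> l2norm x <= B.
Proof.
move=> B0 hB; rewrite -(ler_pXn2r (n := 2)) ?nnegrE ?l2norm_ge0 // l2norm_sqr.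
by apply: limr_le; [exact: l2_cvg | exact: nearW].
Qed.

Lemma l2norm0 : l2norm (0 : H) = 0.
Proof. by rewrite -(scale0r (0 : H)) l2normZ normc0 mul0r. Qed.

Lemma l2normN x : l2norm (- x) = l2norm x.
Proof. by rewrite -scaleN1r l2normZ normc_opp normc1 mul1r. Qed.

Lemma l2norm_distC x y : l2norm (x - y) = l2norm (y - x).
Proof. by rewrite -l2normN opprB. Qed.

Lemma l2normB x y : l2norm (x - y) <= l2norm x + l2norm y.
Proof. by rewrite -(l2normN y) l2normD. Qed.

Lemma l2norm_sum (I : Type) (s : seq I) (Pr : pred I) (F : I -> H) :
  l2norm (\sum_(i <- s | Pr i) F i) <= \sum_(i <- s | Pr i) l2norm (F i).
Proof.
elim/big_ind2 : _ => [|x1 x2 y1 y2 h1 h2|//]; first by rewrite l2norm0.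
by apply: le_trans (l2normD _ _) _; exact: lerD.
Qed.

Lemma l2_ext x y : (forall n, x n = y n) -> x = y.
Proof. by move=> h; apply/val_inj/funext. Qed.

Lemma l2D x y n : (x + y) n = x n + y n. Proof. by []. Qed.
Lemma l2B x y n : (x - y) n = x n - y n. Proof. by []. Qed.
Lemma l2Z a x n : (a *: x) n = a * x n. Proof. by []. Qed.
Lemma l20 n : (0 : H) n = 0. Proof. by []. Qed.
Lemma l2_sum (I : Type) (s : seq I) (Pr : pred I) (F : I -> H) n :
  (\sum_(i <- s | Pr i) F i) n = \sum_(i <- s | Pr i) F i n.
Proof. by elim/big_ind2 : _ => // x1 x2 y1 y2 <- <-. Qed.

Lemma basisE j n : e j n = (n == j)%:R. Proof. by []. Qed.

Lemma inner_is_cvg x y : cvgn (series (fun n => x n * (y n)^*)).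
Proof.
apply: (@series_normc_cvg _ _ (l2norm x ^+ 2 + l2norm y ^+ 2)) => n.
apply: (@le_trans _ _ (sqsum x n + sqsum y n)); last first.
  by rewrite lerD // sqsum_le_l2norm.
rewrite /sqsum /series /= -big_split /=; apply: ler_sum => i _.
rewrite normcM normc_conj.
set s := normc (x i); set t := normc (y i).
have s0 : 0 <= s by exact: Defs.normc_ge0.
have t0 : 0 <= t by exact: Defs.normc_ge0.
(* The termwise bound [s * t <= s ^+ 2 + t ^+ 2] takes the place of Cauchy-Schwarz, which
   presupposes the inner product. *)
by have := sqr_ge0 (s - t); nra.
Qed.

Lemma inner_cvg x y : series (fun n => x n * (y n)^*) n @[n --> \oo] --> inner x y.
Proof. exact: inner_is_cvg. Qed.
Arguments inner_cvg : clear implicits.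

Lemma C_cvg_lim (u : nat -> C) (l : C) : u n @[n --> \oo] --> l -> limn u = l.
Proof. exact: cvg_lim. Qed.

Lemma C_cvg_unique (u v : nat -> C) (a b : C) : u n @[n --> \oo] --> a ->
  v n @[n --> \oo] --> b -> (forall n, u n = v n) -> a = b.
Proof. by move=> /C_cvg_lim <- /C_cvg_lim <- /funext ->. Qed.

Lemma innerDl x y z : inner (x + y) z = inner x z + inner y z.
Proof.
apply: C_cvg_lim; apply: cvg_trans (cvgD (inner_cvg x z) (inner_cvg y z)).
apply: near_eq_cvg; apply: nearW => n.
by rewrite /series /= fctE -big_split; apply: eq_bigr => i _; rewrite /= mulrDl.
Qed.

Lemma innerZl a x z : inner (a *: x) z = a * inner x z.
Proof.
apply: C_cvg_lim; apply: cvg_trans (cvgM (cvg_cst a) (inner_cvg x z)).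
apply: near_eq_cvg; apply: nearW => n.
by rewrite /series /= fctE mulr_sumr; apply: eq_bigr => i _; rewrite /= mulrA.
Qed.

Lemma innerC x y : inner y x = (inner x y)^*.
Proof.
apply: C_cvg_lim; apply/cvg_normcP.
have /cvg_normcP h := inner_cvg x y; apply: cvg_trans h.
apply: near_eq_cvg; apply: nearW => n.
rewrite -[LHS]normc_conj rmorphB /=; congr (normc (_ - _)).
by rewrite /series /= rmorph_sum; apply: eq_bigr => i _; rewrite rmorphM /= conjCK mulrC.
Qed.

Lemma innerDr x y z : inner x (y + z) = inner x y + inner x z.
Proof. by rewrite innerC innerDl rmorphD /= -!innerC. Qed.

Lemma innerZr a x z : inner x (a *: z) = a^* * inner x z.
Proof. by rewrite innerC innerZl rmorphM /= -innerC. Qed.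

Lemma innerNl x y : inner (- x) y = - inner x y.
Proof. by rewrite -scaleN1r innerZl mulN1r. Qed.
Lemma innerNr x y : inner x (- y) = - inner x y.
Proof. by rewrite innerC innerNl rmorphN /= -innerC. Qed.
Lemma innerBl x y z : inner (x - y) z = inner x z - inner y z.
Proof. by rewrite innerDl innerNl. Qed.
Lemma innerBr x y z : inner x (y - z) = inner x y - inner x z.
Proof. by rewrite innerDr innerNr. Qed.
Lemma inner0l x : inner 0 x = 0.
Proof. by rewrite -(scale0r (0 : H)) innerZl mul0r. Qed.
Lemma inner0r x : inner x 0 = 0.
Proof. by rewrite innerC inner0l rmorph0. Qed.

Lemma inner_suml (I : Type) (s : seq I) (Pr : pred I) (F : I -> H) y :
  inner (\sum_(i <- s | Pr i) F i) y = \sum_(i <- s | Pr i) inner (F i) y.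
Proof.
elim/big_ind2 : _ => // [|x1 x2 y1 y2 <- <-]; first exact: inner0l.
by rewrite innerDl.
Qed.

Lemma inner_sumr (I : Type) (s : seq I) (Pr : pred I) (F : I -> H) y :
  inner y (\sum_(i <- s | Pr i) F i) = \sum_(i <- s | Pr i) inner y (F i).
Proof.
elim/big_ind2 : _ => // [|x1 x2 y1 y2 <- <-]; first exact: inner0r.
by rewrite innerDr.
Qed.

Lemma inner_diag x : inner x x = (l2norm x ^+ 2)%:C.
Proof.
apply: C_cvg_lim; apply/cvg_normcP.
have : sqsum x n @[n --> \oo] --> l2norm x ^+ 2.
  by rewrite l2norm_sqr; exact: l2_cvg.
move/cvgrPdist_lt => h; apply/cvgrPdist_lt => eps e0.
have := h _ e0; apply: filterS => n; set s := sqsum x n.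
have -> : series (fun n => x n * (x n)^*) n = s%:C.
  rewrite /s /sqsum /series /= rmorph_sum; apply: eq_bigr => i _.
  by rewrite mul_conj_normc.
by rewrite -rmorphB normc_real sub0r normrN normr_id.
Qed.

Lemma cauchy_schwarz x y : normc (inner x y) <= l2norm x * l2norm y.
Proof.
have [->|y0] := eqVneq y 0.
  by rewrite inner0r normc0 l2norm0 mulr0.
have ny : 0 < l2norm y.
  by rewrite lt_def l2norm_ge0 andbT; apply: contra y0 => /eqP /l2norm_eq0 ->.
pose a := inner x y; pose d := l2norm y ^+ 2.
have d0 : d != 0 by rewrite sqrf_eq0 gt_eqF.
(* The squared distance from [x] to its projection on the line of [y]; its non-negativity is the
   claim, up to clearing [d]. *)
have : inner (x - (a / d%:C) *: y) (x - (a / d%:C) *: y) =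
    (l2norm x ^+ 2 - normc a ^+ 2 / d)%:C.
  rewrite innerBl !innerBr !innerZl !innerZr !inner_diag -/d -/a (innerC x y) -/a.
  have -> : (l2norm x ^+ 2 - normc a ^+ 2 / d)%:C =
      (l2norm x ^+ 2)%:C - a * a^* / d%:C.
    by rewrite mul_conj_normc -fmorphV -rmorphM -rmorphB.
  have dC : d%:C != 0 :> C by rewrite eq_complex /= (negPf d0).
  have dJ : (d%:C : C)^* = d%:C by rewrite conj_Creal //; rewrite complex_real.
  have -> : (a / d%:C)^* = a^* / d%:C by rewrite rmorphM fmorphV /= dJ.
  by field.
rewrite inner_diag => /complexI h.
have : 0 <= l2norm x ^+ 2 - normc a ^+ 2 / d by rewrite -h sqr_ge0.
rewrite subr_ge0 ler_pdivrMr ?exprn_gt0 // -exprMn.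
by rewrite ler_pXn2r // nnegrE ?Defs.normc_ge0 ?mulr_ge0 ?l2norm_ge0.
Qed.

Lemma coord_inner x j : inner x (e j) = x j.
Proof.
apply: C_cvg_lim; apply: cvg_near_cst; exists j.+1 => // n /= jn.
apply/eqP; rewrite /series /= (bigD1_seq j) ?mem_index_iota ?iota_uniq //=.
rewrite eqxx conjC1 mulr1 big1 ?addr0 // => i ij.
by rewrite (negPf ij) conjC0 mulr0.
Qed.

Lemma inner_basisl x j : inner (e j) x = (x j)^*.
Proof. by rewrite innerC coord_inner. Qed.

Lemma l2norm_basis j : l2norm (e j) = 1.
Proof.
apply/eqP; rewrite -(@eqrXn2 _ 2) ?l2norm_ge0 // expr1n.
apply/eqP/(@complexI R); rewrite -inner_diag coord_inner basisE eqxx.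
by [].
Qed.

Lemma normc_coord_le x j : normc (x j) <= l2norm x.
Proof. by rewrite -coord_inner -[leRHS]mulr1 -(l2norm_basis j) cauchy_schwarz. Qed.

Lemma inner_extl x y : (forall z, inner x z = inner y z) -> x = y.
Proof. by move=> h; apply: l2_ext => n; rewrite -!coord_inner. Qed.

End inner_product.

(** * Operators on l2 *)

Section l2_operators.
Variable R : realType.
Local Notation C := (R[i]).
Local Notation H := (l2 R).
Local Notation e := (@l2_basis R).
Implicit Types (x y z : H) (a b : C).

(** The majorant [f] may depend on [eps]: in a density argument the truncation changes with [eps],
    and its cost is bounded uniformly in [n]. *)
Lemma cvg0_approx (g : nat -> R) : (forall n, 0 <= g n) ->
  (forall eps : R, 0 < eps -> exists2 f : nat -> R,
     f n @[n --> \oo] --> (0 : R) & forall n, g n <= f n + eps) ->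
  g n @[n --> \oo] --> (0 : R).
Proof.
move=> g0 h; apply/cvgrPdist_lt => eps e0.
have e2 : 0 < eps / 2 by rewrite divr_gt0.
have [f /cvgrPdist_lt/(_ _ e2) hf gf] := h _ e2.
move: hf; apply: filterS => n /=; rewrite !sub0r !normrN (ger0_norm (g0 n)).
move=> /(le_lt_trans (ler_norm _)) fn.
by apply: le_lt_trans (gf n) _; rewrite [ltRHS]splitr ltrD2r.
Qed.

Lemma cvg0_le (f g : nat -> R) : (forall n, 0 <= g n) ->
  (forall n, g n <= f n) -> f n @[n --> \oo] --> (0 : R) ->
  g n @[n --> \oo] --> (0 : R).
Proof.
move=> g0 gf f0; apply: (squeeze_cvgr _ (cvg_cst 0) f0).
by apply: nearW => n; rewrite g0 gf.
Qed.

Lemma cvg_sum_ord (T : Type) (F : set_system T) {FF : Filter F} (m : nat)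
    (f : 'I_m -> T -> R) (l : 'I_m -> R) :
  (forall j, f j t @[t --> F] --> l j) ->
  \sum_(j < m) f j t @[t --> F] --> \sum_(j < m) l j.
Proof. by move=> h; apply: cvg_big => //; exact: add_continuous. Qed.

Lemma cvg_sum0 (m : nat) (f : 'I_m -> nat -> R) :
  (forall j, f j n @[n --> \oo] --> (0 : R)) ->
  \sum_(j < m) f j n @[n --> \oo] --> (0 : R).
Proof.
move=> h; rewrite [X in _ --> X](_ : _ = \sum_(j < m) (0 : R)).
  exact: cvg_sum_ord.
by rewrite big1.
Qed.

Lemma cvg_normc (T : Type) (F : set_system T) {FF : Filter F}
    (u : T -> C) (l : C) :
  u t @[t --> F] --> l -> normc (u t) @[t --> F] --> normc l.
Proof.
move=> /cvg_normcP/cvgrPdist_lt h; apply/cvgrPdist_lt => eps /h.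
apply: filterS => t; rewrite sub0r normrN ger0_norm ?Defs.normc_ge0 //.
apply: le_lt_trans; rewrite ler_norml; apply/andP; split.
  rewrite lerNl opprB lerBlDr -normc_distC.
  by rewrite -[u t in leLHS](subrK l) Defs.le_normcD.
by rewrite lerBlDr -[l in leLHS](subrK (u t)) Defs.le_normcD.
Qed.

Lemma l2_dominated (f : nat -> C) (z : H) :
  (forall i, normc (f i) <= normc (z i)) -> f \in @l2_pred R.
Proof.
move=> fz; apply/asboolP; apply: (@sqsum_cvg_bounded _ _ (l2norm z ^+ 2)) => n.
apply: le_trans (sqsum_le_l2norm z n); rewrite /sqsum /series /=.
by apply: ler_sum => i _; rewrite lerXn2r ?nnegrE ?Defs.normc_ge0.
Qed.

Lemma l2norm_dominated (x z : H) (c : R) : 0 <= c ->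
  (forall i, normc (x i) <= c * normc (z i)) -> l2norm x <= c * l2norm z.
Proof.
move=> c0 h; apply: l2norm_le; first by rewrite mulr_ge0 ?l2norm_ge0.
move=> n; rewrite exprMn; apply: (@le_trans _ _ (c ^+ 2 * sqsum z n)).
  rewrite /sqsum /series /= mulr_sumr; apply: ler_sum => i _.
  by rewrite -exprMn lerXn2r ?nnegrE ?mulr_ge0 ?Defs.normc_ge0.
by rewrite ler_wpM2l ?sqr_ge0 ?sqsum_le_l2norm.
Qed.

(** A form of dominated convergence: the first [n] coordinates of the error vanish and the others
    are dominated by [z], so its squared norm is at most the tail of the convergent series of
    [z]. *)
Lemma l2_tail_cvg (u : nat -> H) (x z : H) :
  (forall n i, (i < n)%N -> u n i = x i) ->
  (forall n i, normc (x i - u n i) <= normc (z i)) ->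
  u n @[n --> \oo] --> x.
Proof.
move=> ux uz; apply/cvg_l2P.
have key n m : sqsum (x - u n : H) m <= l2norm z ^+ 2 - sqsum z n.
  apply: (@le_trans _ _ (sqsum (x - u n : H) (n + m))).
    by apply: sqsum_nd; exact: leq_addl.
  rewrite lerBrDr; apply: le_trans (sqsum_le_l2norm z (n + m)).
  elim: m => [|m IH].
    rewrite addn0 gerDr sqsumE big1 // => i _.
    have -> : normc ((x - u n : H) i) = 0 by rewrite l2B ux ?ltn_ord // subrr; exact: normc0.
    by rewrite expr0n.
  rewrite addnS !sqsumS addrAC lerD // lerXn2r ?nnegrE ?Defs.normc_ge0 //.
  exact: uz.
apply/cvgrPdist_lt => eps e0.
have : sqsum z n @[n --> \oo] --> l2norm z ^+ 2.
  by rewrite l2norm_sqr; exact: l2_cvg.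
move=> /cvgrPdist_lt /(_ (eps ^+ 2)); rewrite exprn_gt0 // => /(_ isT).
apply: filterS => n; rewrite sub0r normrN !ger0_norm ?l2norm_ge0 ?subr_ge0
  ?sqsum_le_l2norm // => hn.
rewrite -(ltr_pXn2r (n := 2)) ?nnegrE ?l2norm_ge0 ?(ltW e0) //.
apply: le_lt_trans hn.
by rewrite (l2norm_sqr (x - u n)); apply: limr_le; [exact: l2_cvg | exact: nearW].
Qed.

Definition coord_trunc x n : H := \sum_(j < n) x j *: e j.

Lemma coord_truncE x n i : coord_trunc x n i = if (i < n)%N then x i else 0.
Proof.
rewrite l2_sum; case: ltnP => h.
  rewrite (bigD1 (Ordinal h)) // l2Z basisE eqxx mulr1 big1 ?Monoid.mulm1 // => j ji.
  by rewrite l2Z basisE (_ : (i == j) = false) ?mulr0 // eq_sym; exact: negPf ji.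
rewrite big1 // => j _.
by rewrite l2Z basisE gtn_eqF ?mulr0 // (leq_trans (ltn_ord j)).
Qed.

Lemma coord_trunc_cvg x : coord_trunc x n @[n --> \oo] --> x.
Proof.
apply: (@l2_tail_cvg _ _ x) => n i; rewrite coord_truncE; first by move=> ->.
case: ifP => _; last by rewrite subr0.
by rewrite subrr [normc 0]normc0 Defs.normc_ge0.
Qed.
Arguments coord_trunc_cvg : clear implicits.

Lemma inner_cvgl (T : Type) (F : set_system T) {FF : Filter F}
    (u : T -> H) x y :
  u t @[t --> F] --> x -> inner (u t) y @[t --> F] --> inner x y.
Proof.
move=> /cvg_l2P /cvgrPdist_lt ux; apply/cvg_normcP/cvgrPdist_lt => eps e0.
have y1 : 0 < l2norm y + 1 by rewrite ltr_wpDl ?l2norm_ge0.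
have := ux (eps / (l2norm y + 1)); rewrite divr_gt0 // => /(_ isT).
apply: filterS => t; rewrite !sub0r !normrN !ger0_norm ?l2norm_ge0 ?Defs.normc_ge0 //.
rewrite ltr_pdivlMr // -innerBl => h.
apply: le_lt_trans (cauchy_schwarz _ _) _; apply: le_lt_trans h.
by rewrite ler_wpM2l ?l2norm_ge0 // lerDl.
Qed.

Definition mk_l2op (f : H -> H) (hf : linear f) : l2op R :=
  HB.pack f (GRing.isLinear.Build _ _ _ _ f hf).

Lemma bounded_opP (A : l2op R) : bounded_op A ->
  exists2 c : R, 0 <= c & forall x, l2norm (A x) <= c * l2norm x.
Proof.
case=> c hc; exists `|c| => // x; apply: le_trans (hc x) _.
by rewrite ler_wpM2r ?l2norm_ge0 ?ler_norm.
Qed.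

Lemma bounded_op_cvg (A : l2op R) (u : nat -> H) x : bounded_op A ->
  u n @[n --> \oo] --> x -> A (u n) @[n --> \oo] --> A x.
Proof.
move=> /bounded_opP[c c0 hc] /cvg_l2P ux; apply/cvg_l2P.
apply: (@cvg0_le (fun n => c * l2norm (x - u n))) => [n|n|].
- exact: l2norm_ge0.
- by rewrite -linearB hc.
- by rewrite -(mulr0 c); apply: cvgM => //; exact: cvg_cst.
Qed.

Lemma l2op_trunc (A : l2op R) x n :
  A (coord_trunc x n) = \sum_(j < n) x j *: A (e j).
Proof. by rewrite linear_sum; apply: eq_bigr => j _; rewrite linearZ. Qed.

Section adjoint.
Variable A : l2op R.
Hypothesis bA : bounded_op A.

(** With [v] the truncation of the sequence [b] to [n] coordinates, [inner (A v) y] and the squared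
    norm of [v] both equal [sqsum b n]. Boundedness gives
    [l2norm v ^+ 2 <= c * l2norm v * l2norm y], and dividing by [l2norm v] bounds [sqsum b n]
    independently of [n]. *)
Lemma adj_seq_l2 y : (fun j => inner y (A (e j))) \in @l2_pred R.
Proof.
have [c c0 hc] := bounded_opP bA.
set b := fun j => inner y (A (e j)).
apply/asboolP; apply: (@sqsum_cvg_bounded _ _ ((c * l2norm y) ^+ 2)) => n.
pose v : H := \sum_(j < n) b j *: e j.
have S0 := sqsum_ge0 b n.
have bS : \sum_(j < n) b j * (b j)^* = (sqsum b n)%:C.
  rewrite /sqsum /series /= big_mkord rmorph_sum; apply: eq_bigr => i _.
  by rewrite mul_conj_normc.
have vv : l2norm v ^+ 2 = sqsum b n.
  apply: (@complexI R); rewrite -inner_diag -bS inner_sumr.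
  apply: eq_bigr => i _; rewrite innerZr coord_inner l2_sum.
  rewrite (bigD1 i) // l2Z basisE eqxx mulr1 big1 ?Monoid.mulm1 1?mulrC // => j ji.
  by rewrite l2Z basisE (_ : (_ == _) = false) ?mulr0 // eq_sym; exact: negPf ji.
have Av : inner (A v) y = (sqsum b n)%:C.
  rewrite linear_sum inner_suml -bS; apply: eq_bigr => i _.
  by rewrite linearZ innerZl (innerC y).
have : sqsum b n <= c * l2norm v * l2norm y.
  rewrite -(ger0_norm S0) -normc_real -Av.
  apply: le_trans (cauchy_schwarz _ _) _.
  by rewrite ler_wpM2r ?l2norm_ge0.
rewrite -vv; have := l2norm_ge0 v; have := l2norm_ge0 y.
move: (l2norm v) (l2norm y) => s t t0 s0 h.
have ct : 0 <= c * t by rewrite mulr_ge0.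
rewrite lerXn2r ?nnegrE //.
have [->//|sn0] := eqVneq s 0.
have sp : 0 < s by rewrite lt_def sn0.
by rewrite -(ler_pM2l sp) -expr2; apply: le_trans h _; rewrite mulrCA mulrA.
Qed.

(** Riesz representation by coordinates: the identity holds for truncations of [x] by linearity and
    extends to [x] because both sides are continuous in [x]. *)
Lemma adj_exists :
  exists B : l2op R, forall x y, inner (A x) y = inner x (B y).
Proof.
pose f y : H := L2 (adj_seq_l2 y).
have hf : linear f.
  by move=> a x y; apply: l2_ext => n; rewrite l2D l2Z /= innerDl innerZl.
exists (mk_l2op hf) => x y.
have h1 : inner (A (coord_trunc x n)) y @[n --> \oo] --> inner (A x) y.
  by apply: inner_cvgl; apply: bounded_op_cvg => //; exact: coord_trunc_cvg.
have h2 : inner (coord_trunc x n) (f y) @[n --> \oo] --> inner x (f y).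
  by apply: inner_cvgl; exact: coord_trunc_cvg.
apply: (C_cvg_unique h1 h2) => n; rewrite l2op_trunc !inner_suml; apply: eq_bigr => j _.
by rewrite !innerZl inner_basisl /= -innerC.
Qed.

Lemma adjP x y : inner (A x) y = inner x (adj A y).
Proof. by rewrite /adj; case: xgetP => [B _ ->//|]; have [B hB] := adj_exists => /(_ B). Qed.

Lemma adjP2 x y : inner (adj A x) y = inner x (A y).
Proof. by rewrite innerC -adjP -innerC. Qed.

End adjoint.

Definition coord_proj_seq (J : set nat) x : nat -> C :=
  fun i => if i \in J then x i else 0.

Lemma coord_proj_l2 (J : set nat) x : coord_proj_seq J x \in @l2_pred R.
Proof.
apply: (@l2_dominated _ x) => i; rewrite /coord_proj_seq.
by case: ifP => // _; rewrite [normc 0]normc0 Defs.normc_ge0.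
Qed.

Lemma coord_proj_linear (J : set nat) :
  linear (fun x => L2 (coord_proj_l2 J x)).
Proof.
move=> a x y; apply: l2_ext => n; rewrite l2D l2Z /= /coord_proj_seq.
by case: ifP; rewrite ?l2D ?l2Z // mulr0 addr0.
Qed.

Definition coord_proj (J : set nat) : l2op R := mk_l2op (coord_proj_linear J).

Lemma coord_projE J x i : coord_proj J x i = if i \in J then x i else 0.
Proof. by []. Qed.

Lemma coord_proj_le J x : l2norm (coord_proj J x) <= l2norm x.
Proof.
rewrite -[leRHS]mul1r; apply: l2norm_dominated => // i; rewrite mul1r coord_projE.
by case: ifP => // _; rewrite [normc 0]normc0 Defs.normc_ge0.
Qed.

Lemma coord_proj_basis J j : coord_proj J (e j) = if j \in J then e j else 0.
Proof.
apply: l2_ext => n; rewrite coord_projE basisE; case: eqVneq => [->|nj].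
  by case: ifP => _ //; rewrite basisE eqxx.
by case: ifP => _; case: ifP => _ //; rewrite basisE (negPf nj).
Qed.

Lemma coord_proj_sum J x n :
  \sum_(j < n | (j : nat) \in J) x j *: e j = coord_trunc (coord_proj J x) n.
Proof.
rewrite /coord_trunc big_mkcond; apply: eq_bigr => j _; rewrite coord_projE.
by case: ifP => _ //; rewrite scale0r.
Qed.

Lemma lspan_mem (S : set H) x : S x -> lspan S x.
Proof.
move=> Sx; exists 1%N, (fun=> 1), (fun=> x); split=> //.
by rewrite big_ord1 scale1r.
Qed.

Lemma lspan_min (S V : set H) : V 0 ->
  (forall a x y, V x -> V y -> V (a *: x + y)) -> S `<=` V -> lspan S `<=` V.
Proof.
move=> V0 VD SV _ [n [c [v [Sv ->]]]]; elim/big_ind : _ => //.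
  by move=> x y Vx Vy; rewrite -[x]scale1r; exact: VD.
by move=> i _; rewrite -[_ *: _]addr0; apply: VD => //; exact: SV.
Qed.

Lemma lspan0 (S : set H) : lspan S 0.
Proof.
by exists 0%N, (fun=> 0), (fun=> 0); split=> [[]//|]; rewrite big_ord0.
Qed.

Lemma lspan_lin (S : set H) a x y : lspan S x -> lspan S y ->
  lspan S (a *: x + y).
Proof.
move=> [n [c [v [Sv ->]]]] [n' [c' [v' [Sv' ->]]]].
exists (n + n')%N, (fun i => match fintype.split i with inl i => a * c i | inr i => c' i end),
  (fun i => match fintype.split i with inl i => v i | inr i => v' i end); split.
  by move=> i; case: (fintype.split i).
rewrite big_split_ord /=; congr (_ + _).
  by rewrite scaler_sumr; apply: eq_bigr => i _; rewrite (unsplitK (inl i)) scalerA.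
by apply: eq_bigr => i _; rewrite (unsplitK (inr i)).
Qed.

Lemma lspanZ (S : set H) a x : lspan S x -> lspan S (a *: x).
Proof. by move=> h; rewrite -[_ *: _]addr0; apply: lspan_lin => //; exact: lspan0. Qed.

Lemma lspanD (S : set H) x y : lspan S x -> lspan S y -> lspan S (x + y).
Proof. by move=> h1 h2; rewrite -[x]scale1r; exact: lspan_lin. Qed.

Lemma lspan_sum (S : set H) (I : Type) (s : seq I) (Pr : pred I) (F : I -> H) :
  (forall i, Pr i -> lspan S (F i)) -> lspan S (\sum_(i <- s | Pr i) F i).
Proof. by move=> h; apply: big_ind => //; [exact: lspan0|exact: lspanD]. Qed.

(** [xget] selects some operator with the defining property, so uniqueness is the point: the
    difference of two candidates at [x] lies in [V] and is orthogonal to [V]. *)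
Lemma orthoprojE (V : set H) (P0 : l2op R) :
  (forall x y, V x -> V y -> V (x - y)) ->
  (forall x, V (P0 x) /\ forall y, V y -> inner (x - P0 x) y = 0) ->
  forall x, orthoproj V x = P0 x.
Proof.
move=> VB hP x; rewrite /orthoproj; case: xgetP => [P1 _ /= h1|/(_ P0)//].
have [v0 o0] := hP x; have [v1 o1] := h1 x.
apply/eqP; rewrite -subr_eq0; apply/eqP/l2norm_eq0/eqP.
rewrite -sqrf_eq0; apply/eqP/(@complexI R); rewrite -inner_diag.
set d := P1 x - P0 x.
have Vd : V d by exact: VB.
have dE : d = (x - P0 x) - (x - P1 x) by rewrite opprB addrC addrA subrK.
by rewrite {1}dE innerBl o0 // o1 // subrr.
Qed.

Lemma orthoproj_line (v : H) x : l2norm v = 1 ->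
  orthoproj (lspan [set v]) x = inner x v *: v.
Proof.
move=> v1.
have hf : linear (fun x => inner x v *: v).
  by move=> a y z; rewrite innerDl innerZl scalerDl scalerA.
apply: (@orthoprojE _ (mk_l2op hf)) => [y z hy hz|y] /=.
  by rewrite -scaleN1r addrC; apply: lspan_lin.
split; first by apply: lspanZ; exact: lspan_mem.
apply: lspan_min => [|a z w hz hw|_ ->]; first exact: inner0r.
  by rewrite /= innerDr innerZr hz hw mulr0 addr0.
by rewrite /= innerBl innerZl inner_diag v1 expr1n mulr1 subrr.
Qed.

Lemma closure_cvg (V : set H) (u : nat -> H) x :
  (forall n, V (u n)) -> u n @[n --> \oo] --> x -> closure V x.
Proof.
move=> Vu ux B /ux [n _ hn]; exists (u n); split => //.
by apply: hn => /=.
Qed.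

(** Turns membership in a closed span into a condition on coordinates; the projection onto it then
    becomes the explicit [coord_proj]. *)
Lemma closure_basis (J : set nat) :
  closure (lspan [set e i | i in J]) = [set x | forall i, ~ J i -> x i = 0].
Proof.
apply/seteqP; split=> x.
  move=> clx i nJi; apply/eqP; rewrite -normc_eq0 eq_le Defs.normc_ge0 andbT.
  apply/ler_addgt0Pr => eps e0; rewrite add0r.
  have [y [Vy xy]] : lspan [set e i | i in J] `&` ball x eps%:C !=set0.
    by apply: clx; apply: nbhsx_ballx; rewrite ltcR.
  have yi : y i = 0.
    apply: (lspan_min (V := [set y : H | y i = 0])) Vy => //.
      by move=> a z w hz hw; rewrite /mkset l2D l2Z hz hw mulr0 addr0.
    move=> _ [j Jj <-]; rewrite /mkset basisE; case: eqVneq => // ij.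
    by case: nJi; rewrite ij.
  move: xy; rewrite -ball_normE /ball_ /= norm_l2norm ltcR => /ltW; apply: le_trans.
  by rewrite -[x i]subr0 -yi -l2B normc_coord_le.
move=> xJ; apply: (@closure_cvg _ (coord_trunc x)); last exact: coord_trunc_cvg.
move=> n; apply: lspan_sum => j _; have [Jj|nJj] := pselect (J j).
  by apply: lspanZ; apply: lspan_mem; exists j.
by rewrite xJ // scale0r; exact: lspan0.
Qed.

Lemma inner_disjoint x y : (forall i, x i * (y i)^* = 0) -> inner x y = 0.
Proof.
move=> h; apply: C_cvg_lim; apply: cvg_near_cst; apply: nearW => n.
by rewrite /series /= big1.
Qed.

Lemma orthoproj_basis (J : set nat) x :
  orthoproj (closure (lspan [set e i | i in J])) x = coord_proj J x.
Proof.
rewrite closure_basis; apply: orthoprojE => [y z hy hz i nJi|y].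
  by rewrite l2B hy // hz // subrr.
split=> [i nJi|z hz]; first by rewrite coord_projE memNset.
apply: inner_disjoint => i; have [Ji|nJi] := pselect (J i).
  by rewrite l2B coord_projE mem_set // subrr mul0r.
by rewrite hz // conjC0 mulr0.
Qed.

Section diagonal.
Variables (d : nat -> C) (c : R).
Hypotheses (c0 : 0 <= c) (dc : forall i, normc (d i) <= c).

Lemma diag_l2 x : (fun i => d i * x i) \in @l2_pred R.
Proof.
apply: (@l2_dominated _ (c%:C *: x)) => i.
by rewrite l2Z !normcM normc_real ger0_norm // ler_wpM2r ?Defs.normc_ge0.
Qed.

Lemma diag_linear : linear (fun x => L2 (diag_l2 x)).
Proof.
move=> a x y; apply: l2_ext => n; rewrite l2D l2Z.
by rewrite -[LHS]/(d n * (a *: x + y : H) n) l2D l2Z mulrDr mulrCA.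
Qed.

Definition diag_op : l2op R := mk_l2op diag_linear.

Lemma diag_opE x i : diag_op x i = d i * x i. Proof. by []. Qed.

Lemma diag_op_le x : l2norm (diag_op x) <= c * l2norm x.
Proof.
apply: l2norm_dominated => // i.
by rewrite diag_opE normcM ler_wpM2r ?Defs.normc_ge0.
Qed.

Lemma diag_op_basis j : diag_op (e j) = d j *: e j.
Proof.
apply: l2_ext => i; rewrite diag_opE l2Z basisE.
by case: eqVneq => [->//|]; rewrite !mulr0.
Qed.

End diagonal.

Lemma sot_dense0 (G : nat -> l2op R) (c : R) : 0 <= c ->
  (forall n x, l2norm (G n x) <= c * l2norm x) ->
  (forall j, G n (e j) @[n --> \oo] --> (0 : H)) ->
  forall x, G n x @[n --> \oo] --> (0 : H).
Proof.
move=> c0 Gc Ge x; apply/cvg_l2P; apply: cvg0_approx => [n|eps eps0].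
  exact: l2norm_ge0.
(* Dividing by [c + 1] keeps the tolerance meaningful when [c = 0]. *)
have c1 : 0 < c + 1 by rewrite ltr_wpDl.
have /cvg_l2P/cvgrPdist_lt/(_ (eps / (c + 1))) := coord_trunc_cvg x.
rewrite divr_gt0 // => /(_ isT)[m _ /(_ m (leqnn m))] /=.
rewrite sub0r normrN ger0_norm ?l2norm_ge0 // ltr_pdivlMr // => /ltW hm.
exists (fun n => \sum_(j < m) normc (x j) * l2norm (G n (e j))).
  apply: cvg_sum0 => j; rewrite -(mulr0 (normc (x j))).
  apply: cvgM; first exact: cvg_cst.
  have /cvg_l2P := Ge j; apply: cvg_trans; apply: near_eq_cvg; apply: nearW => n.
  by rewrite sub0r l2normN.
move=> n; rewrite sub0r l2normN -[x in G n x](subrK (coord_trunc x m)) addrC.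
rewrite linearD; apply: le_trans (l2normD _ _) _; apply: lerD.
  rewrite l2op_trunc; apply: le_trans (l2norm_sum _ _ _) _.
  by apply: ler_sum => j _; rewrite l2normZ.
apply: le_trans (Gc _ _) _; apply: le_trans hm.
by rewrite mulrC ler_wpM2l ?l2norm_ge0 // lerDl.
Qed.

Lemma wot_dense0 (G : nat -> l2op R) (c : R) : 0 <= c ->
  (forall n x, l2norm (G n x) <= c * l2norm x) ->
  (forall i j, inner (G n (e j)) (e i) @[n --> \oo] --> (0 : C)) ->
  forall x y, inner (G n x) y @[n --> \oo] --> (0 : C).
Proof.
move=> c0 Gc Ge x y; apply/cvg_normcP; apply: cvg0_approx => [n|eps eps0].
  exact: Defs.normc_ge0.
have approx z (B : R) : 0 <= B -> exists m, B * l2norm (z - coord_trunc z m) <= eps / 2.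
  move=> B0; have B1 : 0 < B + 1 by rewrite ltr_wpDl.
  have /cvg_l2P/cvgrPdist_lt/(_ (eps / 2 / (B + 1))) := coord_trunc_cvg z.
  rewrite !divr_gt0 // => /(_ isT)[m _ /(_ m (leqnn m))] /=.
  rewrite sub0r normrN ger0_norm ?l2norm_ge0 // ltr_pdivlMr // => /ltW hm.
  exists m; apply: le_trans hm.
  by rewrite mulrC ler_wpM2l ?l2norm_ge0 // lerDl.
have [m hm] := approx x (c * l2norm y) (mulr_ge0 c0 (l2norm_ge0 y)).
(* [y] is truncated after [x], since its tolerance involves the norm of the truncated [x]. *)
have [k hk] := approx y (c * l2norm (coord_trunc x m)) (mulr_ge0 c0 (l2norm_ge0 _)).
exists (fun n => \sum_(j < m) \sum_(i < k)
    normc (x j) * normc (y i) * normc (inner (G n (e j)) (e i))).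
  apply: cvg_sum0 => j; apply: cvg_sum0 => i; rewrite -(mulr0 (normc (x j) * normc (y i))).
  apply: cvgM; first exact: cvg_cst.
  have /cvg_normcP := Ge i j; apply: cvg_trans; apply: near_eq_cvg; apply: nearW => n.
  by rewrite sub0r normc_opp.
move=> n; rewrite sub0r normc_opp.
set xm := coord_trunc x m; set yk := coord_trunc y k.
have -> : inner (G n x) y = inner (G n xm) yk +
    (inner (G n (x - xm)) y + inner (G n xm) (y - yk)).
  by rewrite linearB innerBl innerBr; ring.
apply: le_trans (Defs.le_normcD _ _) _; apply: lerD.
  rewrite /xm l2op_trunc inner_suml; apply: le_trans (normc_sum _ _ _) _.
  apply: ler_sum => j _; rewrite innerZl inner_sumr mulr_sumr.
  apply: le_trans (normc_sum _ _ _) _; apply: ler_sum => i _.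
  by rewrite innerZr !normcM normc_conj mulrA.
rewrite [leRHS]splitr; apply: le_trans (Defs.le_normcD _ _) _; apply: lerD.
  apply: le_trans (cauchy_schwarz _ _) _; apply: le_trans hm.
  by rewrite mulrAC ler_wpM2r ?l2norm_ge0.
apply: le_trans (cauchy_schwarz _ _) _; apply: le_trans hk.
by rewrite ler_wpM2r ?l2norm_ge0.
Qed.

(** Compactness of a segment gives the real and imaginary parts cluster points along [U]; an
    ultrafilter contains the preimage of every neighbourhood or its complement, so a cluster point
    is a limit. *)
Lemma ultra_bounded_cvg (U : set_system nat) (u : nat -> C) (B : R) :
  UltraFilter U -> (forall n, normc (u n) <= B) ->
  exists l : C, u n @[n --> U] --> l.
Proof.
move=> UU uB.
have UF : ProperFilter U by exact: ultra_proper.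
have real_cvg (f : nat -> R) : (forall n, `|f n| <= B) ->
    exists l : R, f n @[n --> U] --> l.
  move=> fB; have : compact `[- B, B]%classic by exact: segment_compact.
  have hU : U (f @^-1` `[- B, B]%classic).
    by apply: filterE => n /=; rewrite in_itv /= -ler_norml.
  move=> /(_ (f @ U) _ hU)[l [_ lcl]].
  exists l; apply/cvgrPdist_lt => eps e0.
  have [//|hC] := in_ultra_setVsetC [set n | `|l - f n| < eps] UU.
  have [r [/= + lr]] : (~` ball l eps) `&` ball l eps !=set0.
    apply: lcl; last exact: nbhsx_ballx.
    by rewrite -ball_normE; exact: hC.
  by case.
have [a ha] := real_cvg (fun n => complex.Re (u n)) (fun n => le_trans (normc_ge_Re _) (uB n)).
have [b hb] := real_cvg (fun n => complex.Im (u n)) (fun n => le_trans (normc_ge_Im _) (uB n)).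
by exists (a +i* b); exact: cvg_complexP.
Qed.

(* A limit along an ultrafilter exists for each entry; as there are countably many
   entries, a subsequence can then be chosen diagonally. *)
Lemma weak_compact (A : nat -> l2op R) (c : R) : 0 <= c ->
  (forall n x, l2norm (A n x) <= c * l2norm x) ->
  exists psi : nat -> nat, {homo psi : i j / (i < j)%N} /\
    exists B : l2op R, (forall x, l2norm (B x) <= c * l2norm x) /\
      forall x y, inner (A (psi n) x) y @[n --> \oo] --> inner (B x) y.
Proof.
move=> c0 Ac.
have [U [UU oU]] := ultraFilterLemma eventually_filter.
have UF : ProperFilter U by exact: ultra_proper.
have /choice[b hb] : forall x, exists b : nat -> C,
    forall i, A n x i @[n --> U] --> b i.
  move=> x; have /choice[b hb] : forall i, exists l : C, A n x i @[n --> U] --> l.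
    move=> i; apply: (@ultra_bounded_cvg _ _ (c * l2norm x)) => n.
    exact: le_trans (normc_coord_le _ _) (Ac _ _).
  by exists b.
(* A Fatou argument: partial sums pass to the limit along [U], so the coordinatewise limit stays in
   l2 with the same bound. *)
have bB x n : sqsum (b x) n <= (c * l2norm x) ^+ 2.
  have h1 : (\sum_(i < n) normc (A k x i) ^+ 2) @[k --> U] -->
      \sum_(i < n) normc (b x i) ^+ 2.
    apply: cvg_sum_ord => i; rewrite expr2.
    by apply: cvgM; apply: cvg_normc; exact: hb.
  rewrite sqsumE; apply: (ler_cvg_to h1 (cvg_cst _)).
  apply: nearW => k; rewrite -sqsumE; apply: le_trans (sqsum_le_l2norm _ _) _.
  by rewrite lerXn2r ?nnegrE ?mulr_ge0 ?l2norm_ge0.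
have bl2 x : b x \in @l2_pred R by apply/asboolP; exact: sqsum_cvg_bounded (bB x).
pose f x : H := L2 (bl2 x).
have hf : linear f.
  move=> a x y; apply: l2_ext => i.
  have h1 := hb (a *: x + y) i.
  have h2 : (a * A n x i + A n y i) @[n --> U] --> a * b x i + b y i.
    by apply: cvgD (hb y i); apply: cvgM (hb x i); exact: cvg_cst.
  have E n : A n (a *: x + y) i = a * A n x i + A n y i by rewrite linearP.
  rewrite (eq_cvg _ _ E) in h1.
  exact: (cvg_unique (@norm_hausdorff _ C) h1 h2).
have near_entries k : \forall n \near U, forall i j : 'I_k,
    normc (inner (f (e j)) (e i) - inner (A n (e j)) (e i)) < k.+1%:R^-1.
  apply: filter_forall => i; apply: filter_forall => j.
  have /cvg_normcP/cvgrPdist_lt/(_ k.+1%:R^-1) := hb (e j) i.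
  rewrite invr_gt0 ltr0n => /(_ isT); apply: filterS => n.
  by rewrite sub0r normrN ger0_norm ?Defs.normc_ge0 // !coord_inner.
have /choice[next hnext] : forall km : nat * nat, exists n, (km.2 < n)%N /\
    forall i j : 'I_km.1,
    normc (inner (f (e j)) (e i) - inner (A n (e j)) (e i)) < km.1.+1%:R^-1.
  case=> k m /=; apply: (@filter_ex _ U); apply: filterI (near_entries k).
  by apply: oU; exists m.+1.
(* [psi k] exceeds its predecessor and makes every entry of the upper left [k] by [k] corner
   accurate to [1 / (k + 1)]; any fixed entry is eventually inside this corner. *)
pose psi := fix psi k := next (k, if k is k'.+1 then psi k' else 0%N).
have psiP k i j : (i < k)%N -> (j < k)%N ->
    normc (inner (f (e j)) (e i) - inner (A (psi k) (e j)) (e i)) < k.+1%:R^-1.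
  move=> ik jk; case: k ik jk => // k ik jk.
  by have [_ /(_ (Ordinal ik) (Ordinal jk))] := hnext (k.+1, psi k).
exists psi; split.
  by apply: homo_ltn => [|k]; [exact: ltn_trans | exact: (hnext (k.+1, psi k)).1].
have fc x : l2norm (f x) <= c * l2norm x.
  by apply: l2norm_le; [rewrite mulr_ge0 ?l2norm_ge0 | exact: bB].
exists (mk_l2op hf); split=> [x|x y]; first exact: fc.
pose G n : l2op R := A (psi n) \- mk_l2op hf.
have G0 : inner (G n x) y @[n --> \oo] --> (0 : C).
  apply: (@wot_dense0 _ (c + c)) => [|n z|i j]; first exact: addr_ge0.
    by rewrite mulrDl; apply: le_trans (l2normB _ _) _; rewrite lerD.
  apply/cvg_normcP/cvgrPdist_lt => eps e0.
  have [k _ hk] := near_infty_natSinv_lt (PosNum e0).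
  exists (maxn k (maxn i j).+1) => // n /=; rewrite geq_max => /andP[kn ijn].
  rewrite !sub0r normrN normc_opp ger0_norm ?Defs.normc_ge0 // innerBl normc_distC.
  apply: lt_trans (hk n kn); apply: psiP => //.
    exact: leq_ltn_trans (leq_maxl i j) ijn.
  exact: leq_ltn_trans (leq_maxr i j) ijn.
apply/cvg_normcP; have /cvg_normcP := G0; apply: cvg_trans.
apply: near_eq_cvg; apply: nearW => n.
by rewrite sub0r normc_opp innerBl normc_distC.
Qed.

End l2_operators.
Arguments coord_proj {R} J.

(** * Spectral projections *)

Section neumann.
Variable R : realType.
Local Notation C := (R[i]).
Local Notation H := (l2 R).
Variable T : l2op R.

Lemma neumann_linear (z : C) (B : l2op R) :
  linear (fun y => z^-1 *: (T (B y) - y)).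
Proof.
move=> a x y; rewrite linearP linearP scalerA [a * _]mulrC -scalerA -scalerDr.
by congr (_ *: _); rewrite scalerBr opprD addrACA.
Qed.

(* (T - z) x = y is the fixed point equation x = z^-1 (T x - y); a weak limit of
   the iterates gives the inverse without using completeness. *)
Definition neumann_step (z : C) (B : l2op R) : l2op R :=
  mk_l2op (neumann_linear z B).

Definition neumann (z : C) (n : nat) : l2op R :=
  iter n (neumann_step z) (\0 : l2op R).

Lemma neumannS z n y : neumann z n.+1 y = z^-1 *: (T (neumann z n y) - y).
Proof. by []. Qed.

(** Makes [id] bounded on the spectrum, as [calculus_fun] demands. When [c < normc z] the iterates
    are bounded and their successive differences decay geometrically, so a weak limit along a
    subsequence still solves the fixed point equation. *)
Lemma spectrum_bounded (c : R) : 0 <= c ->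
  (forall x, l2norm (T x) <= c * l2norm x) ->
  forall z, spectrum T z -> normc z <= c.
Proof.
move=> c0 hc z; apply: contraPT; rewrite -ltNge => cz; apply.
have z0 : 0 < normc z by exact: le_lt_trans cz.
have zn0 : z != 0 by rewrite -normc_eq0 gt_eqF.
(* [K] solves [normc z * K = c * K + 1]: the bound [K * l2norm y] reproduces itself from one iterate
   to the next. *)
pose K := (normc z - c)^-1.
have K0 : 0 < K by rewrite invr_gt0 subr_gt0.
have Bn n y : l2norm (neumann z n y) <= K * l2norm y.
  elim: n => [|n IH]; first by rewrite l2norm0 mulr_ge0 ?l2norm_ge0 ?ltW.
  rewrite neumannS l2normZ normcV ler_pdivrMl //.
  apply: le_trans (l2normB _ _) _; apply: (@le_trans _ _ ((c * K + 1) * l2norm y)).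
    rewrite mulrDl mul1r lerD2r; apply: le_trans (hc _) _.
    by rewrite -mulrA ler_wpM2l.
  rewrite mulrA ler_wpM2r ?l2norm_ge0 // -subr_ge0.
  have -> : normc z * K - (c * K + 1) = 0.
    by rewrite opprD addrA -mulrBl mulfV ?subrr // gt_eqF // subr_gt0.
  by [].
pose s := c / normc z.
have s0 : 0 <= s by rewrite divr_ge0 // ltW.
have s1 : `|s| < 1 by rewrite ger0_norm // ltr_pdivrMr // mul1r.
have diff n y : l2norm (neumann z n.+1 y - neumann z n y) <=
    s ^+ n * (l2norm y / normc z).
  elim: n => [|n IH].
    rewrite neumannS linear0 sub0r subr0 l2normZ l2normN normcV expr0 mul1r.
    by rewrite mulrC.
  rewrite neumannS [in X in _ - X]neumannS -scalerBr opprB addrA subrK -linearB.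
  rewrite l2normZ normcV exprS -mulrA ler_pdivrMl //.
  apply: le_trans (hc _) _.
  by rewrite [leRHS]mulrA [normc z * s]mulrC /s divfK ?gt_eqF // ler_wpM2l.
have [psi [psi_mono [B [hB Bw]]]] := weak_compact (ltW K0) Bn.
have psi_ge n : (n <= psi n)%N.
  elim: n => // n IH; apply: leq_ltn_trans IH _; exact: psi_mono.
have bT : bounded_op T by exists c.
have TB y : T (B y) - z *: B y = y.
  have key v : z^-1 * (inner (T (B y)) v - inner y v) = inner (B y) v.
    have h1 : inner (neumann z (psi n) y) (adj T v) @[n --> \oo] -->
        inner (B y) (adj T v) by exact: Bw.
    (* The iterate of index [(psi n).+1] leaves the subsequence; [diff] shows that the correction
       tends to 0. *)
    have h2 : z^-1 * (inner (neumann z (psi n) y) (adj T v) - inner y v) +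
       (inner (neumann z (psi n) y) v - inner (neumann z (psi n).+1 y) v)
       @[n --> \oo] --> z^-1 * (inner (B y) (adj T v) - inner y v) + 0.
      apply: cvgD.
        apply: cvgM; first exact: cvg_cst.
        exact: cvgB h1 (cvg_cst _).
      apply/cvg_normcP; apply: (@cvg0_le _ (fun n =>
        s ^+ n * (l2norm y / normc z * l2norm v))) => [n|n|].
      - exact: Defs.normc_ge0.
      - rewrite sub0r normc_opp -innerBl; apply: le_trans (cauchy_schwarz _ _) _.
        rewrite mulrA ler_wpM2r ?l2norm_ge0 // l2norm_distC.
        apply: le_trans (diff _ _) _; apply: ler_wpM2r.
          by rewrite divr_ge0 ?l2norm_ge0 // ltW.
        apply: (ler_wiXn2l s0 _ (psi_ge n)).
        by rewrite ltW // -(ger0_norm s0).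
      - rewrite -(mul0r (l2norm y / normc z * l2norm v)).
        by apply: cvgM; [exact: cvg_expr | exact: cvg_cst].
    rewrite addr0 -adjP // in h2.
    apply: (C_cvg_unique h2 (Bw y v)) => n.
    by rewrite neumannS innerZl innerBl -adjP // addrCA subrr addr0.
  have E : z^-1 *: (T (B y) - y) = B y.
    by apply: inner_extl => v; rewrite innerZl innerBl key.
  by rewrite -{2}E scalerA mulfV // scale1r opprB addrC subrK.
exists B; split=> //; first by exists K.
move=> y.
(* [B] is a right inverse by [TB]. Its defect [w] as a left inverse satisfies [T w = z *: w], and
   [c < normc z] then forces [w = 0]. *)
pose w := B (T y - z *: y) - y.
have w0 : T w = z *: w.
  rewrite /w linearB scalerBr; have /eqP := TB (T y - z *: y).
  by rewrite subr_eq => /eqP ->; rewrite addrC -!addrA addKr addrC.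
have : l2norm w = 0.
  apply/eqP; rewrite eq_le l2norm_ge0 andbT leNgt; apply/negP => wp.
  have := hc w; rewrite w0 l2normZ ler_pM2r // leNgt cz //.
by move=> /l2norm_eq0/eqP; rewrite subr_eq0 => /eqP.
Qed.

End neumann.

Section borel_functions.
Variable R : realType.
Local Notation C := (R[i]).

Lemma open_Borel (f : C -> C) :
  (forall U, open U -> <<s @open C >> (f @^-1` U)) -> Borel f.
Proof.
move=> h; apply: (@measurability _ _ (g_sigma_algebraType (@open C))
  (g_sigma_algebraType (@open C)) setT f (@open C) erefl).
by move=> _ [U oU <-]; rewrite setTI; exact: h.
Qed.

Lemma gen_open (U : set C) : open U -> <<s @open C >> U.
Proof. by move=> oU; exact: sub_sigma_algebra. Qed.

Lemma gen_closed (F : set C) : closed F -> <<s @open C >> F.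
Proof.
move=> cF; rewrite -[F]setCK; apply: (@sigma_algebraC C).
by apply: gen_open; exact: closed_openC.
Qed.

Lemma gen_finite (S : set C) : finite_set S -> <<s @open C >> S.
Proof.
move=> fS; apply: gen_closed; apply: (accessible_finite_set_closed.1 _) fS.
by apply: hausdorff_accessible; exact: norm_hausdorff.
Qed.

Lemma gen_setI (A B : set C) :
  <<s @open C >> A -> <<s @open C >> B -> <<s @open C >> (A `&` B).
Proof. exact: (@measurableI _ (g_sigma_algebraType (@open C))). Qed.

Lemma gen_setU (A B : set C) :
  <<s @open C >> A -> <<s @open C >> B -> <<s @open C >> (A `|` B).
Proof. exact: (@measurableU _ (g_sigma_algebraType (@open C))). Qed.

Lemma gen_setC (A : set C) : <<s @open C >> A -> <<s @open C >> (~` A).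
Proof. exact: (@measurableC _ (g_sigma_algebraType (@open C))). Qed.

Lemma Borel_indic (S : set C) : <<s @open C >> S -> Borel (\1_S : C -> C).
Proof.
move=> mS; apply: open_Borel => U oU; rewrite preimage_indic.
have m0 : <<s @open C >> (set0 : set C) by apply: gen_open; exact: open0.
have mT : <<s @open C >> [set: C] by apply: gen_open; exact: openT.
by do 2!case: ifP => _ //; exact: gen_setC.
Qed.

Lemma Borel_id : Borel (id : C -> C).
Proof. by apply: open_Borel => U oU; exact: gen_open. Qed.

(** Points outside [S] are sent to 0, so the complement of [S] joins the preimage of [U] exactly
    when [U] contains 0. *)
Lemma Borel_id_indic (S : set C) :
  <<s @open C >> S -> Borel (fun z : C => z * \1_S z).
Proof.
move=> mS; apply: open_Borel => U oU.
have [U0|U0] := pselect (U 0).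
  have -> : (fun z : C => z * \1_S z) @^-1` U = (S `&` U) `|` ~` S.
    apply/seteqP; split=> z /=; rewrite indicE.
      have [Sz|nSz] := pselect (S z); last by move=> _; right.
      by rewrite mem_set // mulr1 => Uz; left.
    by case=> [[Sz Uz]|nSz]; [rewrite mem_set // mulr1|rewrite memNset // mulr0].
  apply: gen_setU; last exact: gen_setC.
  by apply: gen_setI => //; exact: gen_open.
have -> : (fun z : C => z * \1_S z) @^-1` U = S `&` U.
  apply/seteqP; split=> z /=; rewrite indicE.
    have [Sz|nSz] := pselect (S z); first by rewrite mem_set // mulr1.
    by rewrite memNset // mulr0.
  by case=> [Sz Uz]; rewrite mem_set // mulr1.
by apply: gen_setI => //; exact: gen_open.
Qed.

End borel_functions.

(** * Spectral projections and growth of iterates, from the calculus axioms *)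

Section spectral_projections.
Variables (R : realType) (T : l2op R) (Phi : (R[i] -> R[i]) -> l2op R).
Local Notation C := (R[i]).
Local Notation H := (l2 R).
Hypotheses (bT : bounded_op T) (calc : functional_calculus T Phi).

Let ind (S : set C) : C -> C := \1_S.

Lemma normc_indic (S : set C) z : normc (ind S z) <= 1.
Proof.
rewrite /ind indicE; case: (z \in S); first by rewrite [normc _]normc1.
by rewrite [normc _]normc0.
Qed.

Lemma calc_fun_indic S : <<s @open C >> S -> calculus_fun T (ind S).
Proof.
move=> mS; split; first exact: Borel_indic.
by exists 1 => z _; exact: normc_indic.
Qed.

Lemma calc_fun_id : calculus_fun T id.
Proof.
split; first exact: Borel_id.
have [c c0 hc] := bounded_opP bT.
by exists c => z; exact: spectrum_bounded.
Qed.

Lemma calc_fun_id_indic S :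
  <<s @open C >> S -> calculus_fun T (fun z => z * ind S z).
Proof.
move=> mS; split; first exact: Borel_id_indic.
have [c c0 hc] := bounded_opP bT.
exists c => z sz; rewrite normcM -[leRHS]mulr1 ler_pM ?Defs.normc_ge0 //.
  exact: spectrum_bounded sz.
exact: normc_indic.
Qed.

Lemma indic_compl S x : <<s @open C >> S ->
  Phi (ind (~` S)) x = x - Phi (ind S) x.
Proof.
move=> mS; apply/eqP; rewrite eq_sym subr_eq; apply/eqP.
rewrite -(calc_add calc) //; [|by apply: calc_fun_indic; exact: gen_setC|exact: calc_fun_indic].
rewrite -[LHS](calc_one calc); congr (Phi _ x); apply/funext => z.
rewrite /ind !indicE in_setC; case: (z \in S); rewrite ?add0r ?addr0 //.
Qed.

Lemma indic_mul S S' x : <<s @open C >> S -> <<s @open C >> S' ->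
  Phi (ind S) (Phi (ind S') x) = Phi (ind (S `&` S')) x.
Proof.
move=> mS mS'; rewrite -(calc_mul calc) //; try exact: calc_fun_indic.
by congr (Phi _ x); apply/funext => z; rewrite /ind indicI.
Qed.

Lemma indic_self_adjoint S x y : <<s @open C >> S ->
  inner (Phi (ind S) x) y = inner x (Phi (ind S) y).
Proof.
move=> mS; rewrite (calc_conj calc) //; last exact: calc_fun_indic.
congr (inner x (Phi _ y)); apply/funext => z; rewrite /ind indicE.
by rewrite conjC_nat.
Qed.

Lemma indic_le S x : <<s @open C >> S -> l2norm (Phi (ind S) x) <= l2norm x.
Proof.
move=> mS; rewrite -[leRHS]mul1r; apply: (calc_norm calc).
  exact: calc_fun_indic.
by move=> z _; exact: normc_indic.
Qed.

Lemma indic0 x : Phi (ind set0) x = 0.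
Proof.
(* Rewritten as 0 times itself, so that [calc_scale] yields the value 0. *)
have -> : ind set0 = (fun z => 0 * ind set0 z).
  by apply/funext => z; rewrite mul0r /ind indicE in_set0.
rewrite (calc_scale calc) ?scale0r //; apply: calc_fun_indic.
by apply: gen_open; exact: open0.
Qed.

Lemma calc_comm_indic S x : <<s @open C >> S ->
  T (Phi (ind S) x) = Phi (fun z => z * ind S z) x.
Proof.
move=> mS; rewrite (calc_mul calc) ?(calc_id calc) //; first exact: calc_fun_id.
exact: calc_fun_indic.
Qed.

Lemma indic_comm S x : <<s @open C >> S -> Phi (ind S) (T x) = T (Phi (ind S) x).
Proof.
move=> mS; rewrite calc_comm_indic // -{1}(calc_id calc) -(calc_mul calc) //.
- by congr (Phi _ x); apply/funext => z; rewrite mulrC.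
- exact: calc_fun_indic.
- exact: calc_fun_id.
Qed.

Lemma indic_disjointU S S' x : <<s @open C >> S -> <<s @open C >> S' ->
  S `&` S' = set0 -> Phi (ind (S `|` S')) x = Phi (ind S) x + Phi (ind S') x.
Proof.
move=> mS mS' SS'; rewrite -(calc_add calc); try exact: calc_fun_indic.
congr (Phi _ x); apply/funext => z; rewrite /ind !indicE in_setU.
have : ~ (S `&` S') z by rewrite SS'.
case: (boolP (z \in S)) => [/set_mem Sz|_]; last by rewrite add0r.
case: (boolP (z \in S')) => [/set_mem S'z|_]; last by rewrite addr0.
by case.
Qed.

Variables (N : nat) (lam : nat -> C) (r : R).
Hypotheses
  (lam_inj : forall i j, (i < N)%N -> (j < N)%N -> lam i = lam j -> i = j)
  (lam_gap : forall k z, (k < N)%N -> spectrum T z ->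
    (forall i, (i <= k)%N -> z <> lam i) -> normc z <= r * normc (lam k))
  (r0 : 0 <= r).

Definition eigenproj (k : nat) : l2op R := Phi (\1_[set lam k]).
Let lams (k : nat) : set C := [set lam i | i in [set i | (i < k)%N]].

Let m1 z : <<s @open C >> [set z]. Proof. exact: gen_finite. Qed.

Let mlams k : <<s @open C >> (lams k).
Proof. by apply: gen_finite; apply: finite_image; exact: finite_II. Qed.

Lemma eigenproj_orth k l x : (k < N)%N -> (l < N)%N -> k != l ->
  eigenproj k (eigenproj l x) = 0.
Proof.
move=> kN lN kl; rewrite indic_mul // (_ : _ `&` _ = set0) ?indic0 //.
apply/seteqP; split=> // z [/= -> /lam_inj e]; move/eqP: kl; apply; exact: e.
Qed.

Lemma eigenproj_eigen k x : T (eigenproj k x) = lam k *: eigenproj k x.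
Proof.
rewrite calc_comm_indic // -(calc_scale calc); last exact: calc_fun_indic.
congr (Phi _ x); apply/funext => z; rewrite /ind indicE.
by case: (boolP (z \in _)) => [/set_mem ->//|_]; rewrite !mulr0.
Qed.

Lemma eigenproj_comm k x : eigenproj k (T x) = lam k *: eigenproj k x.
Proof. by rewrite indic_comm // eigenproj_eigen. Qed.

Lemma eigenproj_self_adjoint k x y :
  inner (eigenproj k x) y = inner x (eigenproj k y).
Proof. exact: indic_self_adjoint. Qed.

Lemma lamsS k : lams k.+1 = lams k `|` [set lam k].
Proof.
apply/seteqP; split=> z.
  move=> [i /= ik <-]; move: ik; rewrite ltnS leq_eqVlt => /orP[/eqP->|ik].
    by right.
  by left; exists i.
by move=> [[i /= ik <-]|/= ->]; [exists i => //=; exact: ltnW|exists k => /=].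
Qed.

Lemma proj_lamsS k x : (k < N)%N ->
  Phi (ind (lams k.+1)) x = Phi (ind (lams k)) x + eigenproj k x.
Proof.
move=> kN; rewrite lamsS indic_disjointU //.
apply/seteqP; split=> // z [[i /= ik <-] /= /lam_inj e].
by have := ik; rewrite (e (ltn_trans ik kN) kN) ltnn.
Qed.

Lemma proj_lams_eq0 k x : (k <= N)%N ->
  (forall l, (l < k)%N -> eigenproj l x = 0) -> Phi (ind (lams k)) x = 0.
Proof.
elim: k => [|k IH] kN hx.
  have -> : lams 0 = set0 by apply/seteqP; split=> // z [].
  exact: indic0.
rewrite proj_lamsS // IH ?add0r ?hx //; first exact: ltnW.
by move=> l lk; apply: hx; exact: ltnW.
Qed.

(** [T] commutes with the projection of [S] and so preserves its kernel, where it coincides with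
    [Phi] of the identity cut off to the complement of [S]; [calc_norm] bounds that operator by
    [c]. *)
Lemma iter_proj_compl S (c : R) x n : <<s @open C >> S -> 0 <= c ->
  (forall z, spectrum T z -> ~ S z -> normc z <= c) ->
  Phi (ind S) x = 0 -> l2norm (iter n T x) <= c ^+ n * l2norm x.
Proof.
move=> mS c0 hS x0.
have Sn : Phi (ind S) (iter n T x) = 0.
  by elim: n => [//|n IH]; rewrite iterS indic_comm // IH linear0.
elim: n Sn => [|n IH] Sn; first by rewrite mul1r.
have Sn' : Phi (ind S) (iter n T x) = 0.
  by clear -calc bT mS x0; elim: n => [//|n IH]; rewrite iterS indic_comm // IH linear0.
rewrite iterS exprS -mulrA; apply: le_trans (ler_wpM2l c0 (IH Sn')).
have -> : T (iter n T x) = Phi (fun z => z * ind (~` S) z) (iter n T x).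
  rewrite -calc_comm_indic; last exact: gen_setC.
  by rewrite indic_compl // Sn' subr0.
apply: (calc_norm calc); first by apply: calc_fun_id_indic; exact: gen_setC.
move=> z sz; rewrite /ind indicE in_setC.
case: (boolP (z \in S)) => /= zS; first by rewrite mulr0 [normc _]normc0.
by rewrite mulr1; apply: hS => // /mem_set; exact/negP.
Qed.

(** As the components of [x] before level [k] vanish, [x] is [eigenproj k x] plus a vector carried
    by the rest of the spectrum. [T] multiplies the first part exactly by [lam k] and the second by
    at most [r * normc (lam k)], according to [lam_gap]. *)
Lemma iter_leading k x n : (k < N)%N ->
  (forall l, (l < k)%N -> eigenproj l x = 0) ->
  l2norm (iter n T x - lam k ^+ n *: eigenproj k x) <=
    (r * normc (lam k)) ^+ n * l2norm x.
Proof.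
move=> kN hx.
have E m : iter m T (eigenproj k x) = lam k ^+ m *: eigenproj k x.
  elim: m => [|m IH]; first by rewrite scale1r.
  by rewrite iterS IH linearZ /= eigenproj_eigen scalerA -exprSr.
have iterB m u v : iter m T (u - v) = iter m T u - iter m T v.
  by elim: m => // m IH; rewrite !iterS IH linearB.
have hk : Phi (ind (lams k.+1)) x = eigenproj k x.
  by rewrite proj_lamsS // proj_lams_eq0 ?add0r // ltnW.
have mS := mlams k.+1; have mS' := gen_setC mS.
set y := Phi (ind (~` lams k.+1)) x.
have yE : x - eigenproj k x = y by rewrite /y indic_compl // hk.
have c0 : 0 <= r * normc (lam k) by rewrite mulr_ge0 ?Defs.normc_ge0.
have y0 : Phi (ind (lams k.+1)) y = 0 by rewrite indic_mul // setICr indic0.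
have hz z : spectrum T z -> ~ lams k.+1 z -> normc z <= r * normc (lam k).
  by move=> sz nz; apply: lam_gap => // i ik zi; apply: nz; exists i.
rewrite -E -iterB yE; apply: le_trans (iter_proj_compl n mS c0 hz y0) _.
by apply: ler_wpM2l; [exact: exprn_ge0 | exact: indic_le].
Qed.

Lemma proj_omega_eq0 x : (forall l, (l < N)%N -> eigenproj l x = 0) ->
  Phi (\1_[set lam i | i in [set i | (i < N)%N]]) x = 0.
Proof. exact: proj_lams_eq0. Qed.

End spectral_projections.

(** * QR sequences *)

Section triangular.
Variable R : realType.
Local Notation C := (R[i]).
Local Notation H := (l2 R).
Local Notation e := (@l2_basis R).
Implicit Types (x y z : H) (j n : nat).

Lemma unitary_inner (Q : l2op R) x y : unitary_op Q -> inner (Q x) (Q y) = inner x y.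
Proof. by case=> bQ QK _; rewrite adjP // QK. Qed.

Lemma l2norm_inner (x y : H) : inner x x = inner y y -> l2norm x = l2norm y.
Proof.
rewrite !inner_diag => /complexI/eqP.
by rewrite eqrXn2 ?l2norm_ge0 // => /eqP.
Qed.

Lemma unitary_l2norm (Q : l2op R) x : unitary_op Q -> l2norm (Q x) = l2norm x.
Proof. by move=> uQ; apply: l2norm_inner; rewrite unitary_inner. Qed.

Lemma unitary_adj_l2norm (Q : l2op R) x : unitary_op Q -> l2norm (adj Q x) = l2norm x.
Proof. by move=> uQ; case: (uQ) => _ _ KQ; rewrite -(unitary_l2norm _ uQ) KQ. Qed.

Lemma isometry_unitary (Q : l2op R) :
  (forall x y, inner (Q x) (Q y) = inner x y) ->
  (forall y, exists x, Q x = y) -> unitary_op Q.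
Proof.
move=> Qi Qs.
have bQ : bounded_op Q.
  by exists 1 => x; rewrite mul1r (@l2norm_inner (Q x) x).
have QK x : adj Q (Q x) = x.
  by apply: inner_extl => z; rewrite adjP2.
by split=> // y; have [x <-] := Qs y; rewrite QK.
Qed.

Definition flag j : set H := [set x | forall i, (j <= i)%N -> x i = 0].

Lemma flag_basis j : flag j.+1 (e j).
Proof. by move=> i ji; rewrite basisE gtn_eqF. Qed.

Lemma flagW j j' x : (j <= j')%N -> flag j x -> flag j' x.
Proof. by move=> jj h i ji; apply: h; exact: leq_trans ji. Qed.

Lemma flagZ j a x : flag j x -> flag j (a *: x).
Proof. by move=> hx i ji; rewrite l2Z hx // mulr0. Qed.

Lemma flagD j x y : flag j x -> flag j y -> flag j (x + y).
Proof. by move=> hx hy i ji; rewrite l2D hx // hy // addr0. Qed.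

Lemma flagB j x y : flag j x -> flag j y -> flag j (x - y).
Proof. by move=> hx hy i ji; rewrite l2B hx // hy // subrr. Qed.

Lemma flag_sum j (I : Type) (s : seq I) (Pr : pred I) (F : I -> H) :
  (forall i, Pr i -> flag j (F i)) -> flag j (\sum_(i <- s | Pr i) F i).
Proof.
by move=> h; apply: big_ind => //; exact: flagD.
Qed.

Lemma flag_trunc j x : flag j x -> x = \sum_(i < j) x i *: e i.
Proof.
move=> hx; apply: l2_ext => i; rewrite -[RHS]/(coord_trunc x j i) coord_truncE.
by case: ltnP => // /hx.
Qed.

Lemma flag0 x : flag 0 x -> x = 0.
Proof. by move=> /flag_trunc ->; rewrite big_ord0. Qed.

Lemma flagS_reduce j x y : flag j.+1 x -> flag j.+1 y -> y j != 0 ->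
  flag j (x - (x j / y j) *: y).
Proof.
move=> hx hy yj i; rewrite leq_eqVlt => /orP[/eqP <-|ji].
  by rewrite l2B l2Z divfK // subrr.
by rewrite l2B l2Z (hx i) // (hy i) // mulr0 subrr.
Qed.

Lemma upper_triangular_flag (A : l2op R) j x :
  upper_triangular A -> flag j x -> flag j (A x).
Proof.
move=> uA hx i ji; rewrite (flag_trunc hx) linear_sum l2_sum big1 // => l _.
have Aei : A (e l) i = 0.
  by rewrite -coord_inner; apply: uA; exact: leq_trans (ltn_ord l) ji.
by rewrite linearZ l2Z Aei; exact: mulr0.
Qed.

(** Inverts each [R_n] on finite vectors from injectivity alone. If the diagonal entry [A (e j) j]
    were 0, then [A (e j)] would lie in [flag j] and, by induction, be the image of a vector of
    [flag j], against injectivity. *)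
Lemma flag_surjective (A : l2op R) : injective A ->
  (forall j x, flag j x -> flag j (A x)) ->
  forall j y, flag j y -> exists2 x, flag j x & A x = y.
Proof.
move=> Ainj Aflag; elim=> [|j IH] y hy.
  by exists 0; [move=> i _; exact: l20|rewrite linear0 (flag0 hy)].
have hAe := Aflag _ _ (@flag_basis j).
have Aej : A (e j) j != 0.
  apply/eqP => Aej.
  have : flag j (A (e j)).
    by move=> i; rewrite leq_eqVlt => /orP[/eqP <- //|ji]; exact: hAe.
  move=> /IH[x hx] /Ainj xe; have := hx j (leqnn j).
  by rewrite xe basisE eqxx => /eqP; rewrite oner_eq0.
have [x hx xy] := IH _ (flagS_reduce hy hAe Aej).
exists (x + (y j / A (e j) j) *: e j).
  apply: flagD; first exact: flagW hx.
  by apply: flagZ; exact: flag_basis.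
by rewrite linearD linearZ /= xy subrK.
Qed.

Section QR.
Variables (T : l2op R) (Q Rs : nat -> l2op R).
Hypotheses (iT : invertible_op T) (qr : QR_sequences T Q Rs).

Lemma QR_structure :
  [/\ forall n, unitary_op (Q n),
      forall n x, iter n T x = Q n (Rs n x),
      forall n j x, flag j x -> flag j (Rs n x) &
      forall n, injective (Rs n)].
Proof.
case: qr => Tn [Qf [Rf [T0 step [Q0 QS] [R0 RS]]]].
have Tinj : injective T by case: iT => B [_ TK _]; exact: can_inj TK.
have uQ n : unitary_op (Q n).
  elim: n => [|n IH]; apply: isometry_unitary.
  - by move=> x y; rewrite !Q0.
  - by move=> y; exists y; rewrite Q0.
  - have [uf _ _ _ _] := step n.
    by move=> x y; rewrite !QS /= !unitary_inner.
  - move=> y; have [[_ _ KQf] _ _ _ _] := step n; case: IH => _ _ KQ.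
    by exists (adj (Qf n) (adj (Q n) y)); rewrite QS /= KQf KQ.
(* The intertwining relation [T Q_n = Q_n T_n] carries the factorization [T^n = Q_n R_n] from [n] to
   [n + 1]. *)
have TQ n x : T (Q n x) = Q n (Tn n x).
  elim: n x => [|n IH] x; first by rewrite !Q0 T0.
  have [_ _ _ Tf TS] := step n.
  by rewrite !QS /= IH Tf /= TS.
have QR n x : iter n T x = Q n (Rs n x).
  elim: n => [|n IH]; first by rewrite Q0 R0.
  have [_ _ _ Tf _] := step n.
  by rewrite iterS IH TQ Tf /= QS RS.
split=> // n.
  elim: n => [|n IH] j x hx; first by rewrite R0.
  have [_ _ ut _ _] := step n.
  by rewrite RS /=; apply: upper_triangular_flag => //; exact: IH.
have iterI m : injective (iter m T).
  by elim: m => // m IH x y /Tinj/IH.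
by move=> x y xy; apply: (iterI n); rewrite !QR xy.
Qed.

Definition qtq n : H -> H := fun x => adj (Q n) (T (Q n x)).

Lemma qtq_linear n : linear (qtq n).
Proof. by move=> a x y; rewrite /qtq !linearP. Qed.

Definition qtq_op n : l2op R := mk_l2op (qtq_linear n).

Lemma qtq_le (c : R) n x : unitary_op (Q n) ->
  (forall x, l2norm (T x) <= c * l2norm x) ->
  l2norm (qtq n x) <= c * l2norm x.
Proof.
by move=> uQ hc; rewrite /qtq unitary_adj_l2norm // -(unitary_l2norm x uQ).
Qed.

Lemma finite_nat_bound (A : set nat) : finite_set A ->
  exists K, forall i, A i -> (i < K)%N.
Proof.
move=> /finite_seqP[s ->]; exists (\max_(i <- s) i).+1 => i /= si.
by rewrite ltnS; exact: leq_bigmax_seq.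
Qed.

Lemma column_finite_flag j : column_finite T ->
  exists K, forall x, flag j x -> flag K (T x).
Proof.
move=> cT; elim: j => [|j [K hK]].
  by exists 0%N => x /flag0 ->; rewrite linear0 => i _; exact: l20.
have [K' hK'] := finite_nat_bound (cT j).
exists (maxn K K') => x hx.
have ej : e j j != 0 by rewrite basisE eqxx oner_eq0.
have -> : T x = T (x - (x j / e j j) *: e j) + (x j / e j j) *: T (e j).
  by rewrite -linearZ -linearD subrK.
apply: flagD.
  apply: flagW (leq_maxl _ _) _; apply: hK.
  exact: flagS_reduce hx (@flag_basis j) ej.
apply: flagZ => i; rewrite geq_max => /andP[_ Ki]; rewrite -coord_inner.
by apply/eqP; apply: contraTT Ki => /hK'; rewrite ltnNge.
Qed.

Lemma qtq_flag j : column_finite T ->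
  exists K, forall n, flag K (qtq n (e j)).
Proof.
have [uQ QR Rflag Rinj] := QR_structure.
move=> /(column_finite_flag j.+1)[K hK]; exists K => n.
have [w hw <-] := flag_surjective (Rinj n) (Rflag n) (@flag_basis j).
(* With [e j = R_n w], [T Q_n R_n w = T^n (T w) = Q_n R_n (T w)]; the adjoint of [Q_n] leaves
   [R_n (T w)], in a flag independent of [n]. *)
rewrite /qtq -QR -iterS iterSr QR.
by have [_ -> _] := uQ n; apply: Rflag; exact: hK.
Qed.

End QR.
End triangular.

(** Course-of-values choice. By [ext], [Pr j] only reads the values before [j], so the finite
    histories [F j] can be exchanged for the diagonal function [f]. *)
Lemma sequential_choice (A : Type) (a0 : A) (Pr : nat -> (nat -> A) -> A -> Prop) :
  (forall j f g a, (forall i, (i < j)%N -> f i = g i) -> Pr j f a -> Pr j g a) ->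
  (forall j f, (forall i, (i < j)%N -> Pr i f (f i)) -> exists a, Pr j f a) ->
  exists f, forall j, Pr j f (f j).
Proof.
move=> ext ex.
have /choice[c hc] : forall jf : nat * (nat -> A), exists a,
    (forall i, (i < jf.1)%N -> Pr i jf.2 (jf.2 i)) -> Pr jf.1 jf.2 a.
  case=> j f /=; have [h|h] := pselect (forall i, (i < j)%N -> Pr i f (f i)).
    by have [a ha] := ex j f h; exists a.
  by exists a0.
pose F := fix F n : nat -> A := if n is n'.+1 then
  (fun i => if i == n' then c (n', F n') else F n' i) else (fun=> a0).
pose f j := F j.+1 j.
have Ff n i : (i < n)%N -> F n i = f i.
  elim: n => // n IH; rewrite ltnS leq_eqVlt => /orP[/eqP -> //|lin].
  by rewrite /= ltn_eqF // IH.
exists f; elim/ltn_ind => j IH.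
have fj : f j = c (j, F j) by rewrite /f /= eqxx.
rewrite fj; apply: (ext j (F j)); first exact: Ff.
apply: (hc (j, F j)) => /= i ij; rewrite Ff //.
apply: (ext i f); last exact: IH.
by move=> l li; rewrite Ff // (ltn_trans li).
Qed.

(** * Rate of convergence of Q_n e_j *)

Section perturbation.
Variable R : realType.
Local Notation C := (R[i]).
Local Notation H := (l2 R).

(* [G] selects the indices of level below [N], and [f] is the component of [y]
   along the others. The first estimate bounds the coefficients [a i], the second
   shows that those with [i < j] are O(s), the last that [f] is O(s). *)
Lemma perturbed_orthonormal (j : nat) (g h : nat -> H) (G : pred nat)
    (a : nat -> C) (f y : H) (W s : R) :
  y = \sum_(i < j.+1 | G i) a i *: (g i + h i) + f ->
  l2norm y = 1 -> G j ->
  (forall i l, G i -> G l -> inner (g i) (g l) = (i == l)%:R) ->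
  (forall i, (i < j.+1)%N -> G i -> l2norm (h i) <= W * s) ->
  0 <= W -> 0 <= s -> s <= 1 -> j.+1%:R * (W * s) <= 1 / 2 ->
  (forall i, G i -> inner f (g i) = 0) ->
  (forall i, (i < j)%N -> G i -> inner y (g i + h i) = 0) ->
  inner y f = 0 ->
  l2norm (y - a j *: g j) <=
    2 * ((j.+1%:R * (W + 2 * j.+1%:R * W)) * (1 + W) + 2 * j.+1%:R * W) * s.
Proof.
move=> yE y1 Gj ort hW W0 s0 s1 small fg yg yf.
set J : R := j.+1%:R.
have J0 : 0 <= J by [].
have Ws0 : 0 <= W * s by rewrite mulr_ge0.
have g1 i : G i -> l2norm (g i) = 1.
  move=> Gi; apply/eqP; rewrite -(@eqrXn2 _ 2) ?l2norm_ge0 // expr1n.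
  by apply/eqP/(@complexI R); rewrite -inner_diag ort // eqxx.
pose A := \sum_(i < j.+1 | G i) normc (a i).
have A0 : 0 <= A by apply: sumr_ge0 => i _; exact: Defs.normc_ge0.
(* Pairing [y] with [g i] recovers [a i] up to the contribution of the perturbations [h l]. *)
have hA : forall i, (i < j.+1)%N -> G i ->
    normc (a i - inner y (g i)) <= A * (W * s).
  move=> i ij Gi; rewrite yE innerDl fg // addr0 inner_suml.
  have -> : a i - \sum_(l < j.+1 | G l) inner (a l *: (g l + h l)) (g i) =
     - \sum_(l < j.+1 | G l) a l * inner (h l) (g i).
    have -> : \sum_(l < j.+1 | G l) inner (a l *: (g l + h l)) (g i) =
        \sum_(l < j.+1 | G l) a l * inner (g l) (g i) +
        \sum_(l < j.+1 | G l) a l * inner (h l) (g i).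
      by rewrite -big_split; apply: eq_bigr => l _; rewrite innerZl innerDl mulrDr.
    rewrite (bigD1 (Ordinal ij)) // ort //= eqxx mulr1 big1 ?addr0; last first.
      move=> l /andP[Gl li]; rewrite ort // (_ : (_ == _) = false) ?mulr0 //.
      exact: negPf li.
    by rewrite opprD addrA subrr sub0r.
  rewrite normc_opp; apply: le_trans (normc_sum _ _ _) _; rewrite mulr_suml.
  apply: ler_sum => l Gl; rewrite normcM ler_wpM2l ?Defs.normc_ge0 //.
  by apply: le_trans (cauchy_schwarz _ _) _; rewrite g1 // mulr1 hW.
have sumJ (B : R) : 0 <= B -> \sum_(i < j.+1 | G i) B <= J * B.
  move=> B0; apply: le_trans (_ : \sum_(i < j.+1) B <= _).
    by rewrite big_mkcond; apply: ler_sum => i _; case: ifP.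
  by rewrite sumr_const card_ord -[B *+ _]mulr_natl.
(* [A] bounds itself: [A <= J + A * (J * (W * s))], and the smallness assumption lets half of [A] be
   absorbed on the left. *)
have A2 : A <= 2 * J.
  have : A <= J * (1 + A * (W * s)).
    have t0 : 0 <= 1 + A * (W * s) by rewrite addr_ge0 // mulr_ge0.
    apply: (le_trans _ (sumJ _ t0)).
    apply: ler_sum => i Gi; have := hA i (ltn_ord i) Gi.
    move=> h1; rewrite -(subrK (inner y (g i)) (a i)).
    apply: le_trans (Defs.le_normcD _ _) _; rewrite addrC; apply: lerD => //.
    by apply: le_trans (cauchy_schwarz _ _) _; rewrite y1 g1 // mulr1.
  rewrite mulrDr mulr1 mulrCA -lerBlDr => hle.
  have : A * (J * (W * s)) <= A * (1 / 2) by rewrite ler_wpM2l.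
  move: hle; set t := A * (J * (W * s)) => hle ht; lra.
(* For [i < j], [inner y (g i) = - inner y (h i)] contributes [W * s]; [hA] with [A2] contributes
   [2 * J * W * s]. *)
pose B := W + 2 * J * W.
have B0 : 0 <= B by rewrite addr_ge0 ?mulr_ge0.
have hB i : (i < j)%N -> G i -> normc (a i) <= B * s.
  move=> ij Gi; have ij' : (i < j.+1)%N by exact: ltnW.
  rewrite -(subrK (inner y (g i)) (a i)); apply: le_trans (Defs.le_normcD _ _) _.
  rewrite addrC /B mulrDl; apply: lerD.
    have /eqP := yg i ij Gi; rewrite innerDr addr_eq0 => /eqP ->; rewrite normc_opp.
    by apply: le_trans (cauchy_schwarz _ _) _; rewrite y1 mul1r hW.
  apply: le_trans (hA i ij' Gi) _; rewrite -mulrA ler_wpM2r //.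
(* [d] collects the terms with [i < j], of total norm at most [J * B * (1 + W) * s], and
   [a j *: h j], of norm at most [2 * J * W * s]. *)
pose d := y - a j *: g j - f.
pose D := (J * B * (1 + W) + 2 * J * W) * s.
have hd : l2norm d <= D.
  have -> : d = \sum_(i < j.+1 | G i && (i != j :> nat)) a i *: (g i + h i) + a j *: h j.
    rewrite /d yE (bigD1 ord_max) //= scalerDr.
    rewrite [X in _ - X](_ : _ = 0 + f) ?add0r //.
    by rewrite addrAC addrK -!addrA addrC addrA subrK addrC.
  apply: le_trans (l2normD _ _) _; rewrite /D mulrDl; apply: lerD.
    apply: le_trans (l2norm_sum _ _ _) _.
    have t0 : 0 <= B * (1 + W) * s by rewrite !mulr_ge0 // addr_ge0.
    have -> : J * B * (1 + W) * s = J * (B * (1 + W) * s) by rewrite !mulrA.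
    apply: (le_trans _ (sumJ _ t0)).
    rewrite big_mkcondr; apply: ler_sum => i Gi; case: ifP => [ij|_]; last first.
      by rewrite !mulr_ge0 // addr_ge0.
    have ij' : (i < j)%N by rewrite ltn_neqAle ij -ltnS ltn_ord.
    rewrite l2normZ [leRHS]mulrAC; apply: ler_pM; rewrite ?Defs.normc_ge0 ?l2norm_ge0 //.
      exact: hB.
    apply: le_trans (l2normD _ _) _; rewrite g1 // lerD2l.
    apply: le_trans (hW _ _ Gi) _ => //.
    by rewrite -[leRHS]mulr1 ler_wpM2l.
  rewrite l2normZ -[leRHS]mulrA; apply: ler_pM; rewrite ?Defs.normc_ge0 ?l2norm_ge0 //.
    apply: le_trans A2; rewrite /A (bigD1 ord_max) //= lerDl.
    by apply: sumr_ge0 => i _; exact: Defs.normc_ge0.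
  exact: hW.
(* [f] is orthogonal to [y] and to [g j], so [inner f f = - inner d f] and [f] is no larger than
   [d]; hence the factor 2 in the conclusion. *)
have fD : l2norm f <= D.
  have [->|f0] := eqVneq (l2norm f) 0.
    by apply: le_trans hd; exact: l2norm_ge0.
  have fp : 0 < l2norm f by rewrite lt_def f0 l2norm_ge0.
  have E : inner f f = - inner d f.
    rewrite /d !innerBl yf innerZl (innerC f (g j)) fg // conjC0 mulr0 subrr sub0r opprK.
    by [].
  rewrite -(ler_pM2l fp); apply: (@le_trans _ _ (l2norm d * l2norm f)); last first.
    by rewrite mulrC ler_wpM2l // ltW.
  apply: le_trans (cauchy_schwarz _ _).
  by rewrite -normc_opp -E inner_diag normc_real ger0_norm ?sqr_ge0.
have -> : y - a j *: g j = d + f by rewrite /d subrK.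
apply: le_trans (l2normD _ _) _.
by rewrite -mulrA mulrDl mul1r lerD.
Qed.

End perturbation.

(** * Gaussian elimination along the flag *)

Section adapted_basis.
Variable R : realType.
Local Notation C := (R[i]).
Local Notation H := (l2 R).
Local Notation e := (@l2_basis R).
Variables (N : nat) (E : nat -> l2op R).
Hypotheses
  (E_orth : forall k l x, (k < N)%N -> (l < N)%N -> k != l -> E k (E l x) = 0)
  (E_sa : forall k x y, inner (E k x) y = inner x (E k y)).

(* [f i] is the pair of the basis vector [w_i] and its level [k(i)]; level [N] means
   that [w_i] is orthogonal to all the eigenspaces. *)
Definition adapted (j : nat) (f : nat -> H * nat) (a : H * nat) : Prop :=
  [/\ flag j.+1 a.1, a.1 j != 0, (a.2 <= N)%N,
      forall l, (l < a.2)%N -> E l a.1 = 0 &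
      (a.2 < N)%N -> l2norm (E a.2 a.1) = 1 /\
        forall i, (i < j)%N -> (f i).2 = a.2 ->
          inner (E a.2 a.1) (E a.2 (f i).1) = 0].

(** Starts from [e j] and climbs the levels. At level [l] the components along earlier vectors of
    that level are removed; if [E l] does not kill the result, normalising it ends the search,
    otherwise the result passes to level [l.+1]. Reaching [N] gives a vector of top level. *)
Lemma adapted_step j (f : nat -> H * nat) :
  (forall i, (i < j)%N -> adapted i f (f i)) -> exists a, adapted j f a.
Proof.
move=> hf.
have ort l i i' : (l < N)%N -> (i < j)%N -> (i' < j)%N ->
    (f i).2 = l -> (f i').2 = l ->
    inner (E l (f i).1) (E l (f i').1) = (i == i')%:R.
  move=> lN ij ij' fi fi'; case: (ltngtP i i') => [ii'|ii'|<-].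
  - have [_ _ _ _ h] := hf i' ij'; move: h; rewrite fi' => /(_ lN)[_ h].
    by rewrite innerC h // conjC0.
  - have [_ _ _ _ h] := hf i ij; move: h; rewrite fi => /(_ lN)[_ h].
    by rewrite h.
  - have [_ _ _ _ h] := hf i ij; move: h; rewrite fi => /(_ lN)[h _].
    by rewrite inner_diag h expr1n.
suff main l : (l <= N)%N -> (exists a, adapted j f a) \/
    exists x, [/\ flag j.+1 x, x j != 0 & forall l', (l' < l)%N -> E l' x = 0].
  have [//|[x [fx xj Ex]]] := main N (leqnn N).
  by exists (x, N); split=> //=; rewrite ltnn.
elim: l => [_|l IH lN].
  right; exists (e j); split=> //; first exact: flag_basis.
  by rewrite basisE eqxx oner_eq0.
have [|[x [fx xj Ex]]] := IH (ltnW lN); first by left.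
pose c i := inner (E l x) (E l (f i).1).
(* The correction uses the vectors [(f i).1] and not their projections: they lie in [flag j], so
   coordinate [j] of [x] is untouched, and the lower [E l'] kill them. *)
pose y := x - \sum_(i < j | (f i).2 == l) c i *: (f i).1.
have fs : flag j (\sum_(i < j | (f i).2 == l) c i *: (f i).1).
  apply: flag_sum => i _; apply: flagZ.
  by have [h _ _ _ _] := hf i (ltn_ord i); apply: flagW h.
have fy : flag j.+1 y by apply: flagB fx _; apply: flagW fs.
have yj : y j != 0 by rewrite /y l2B fs // subr0.
have Ey l' : (l' < l)%N -> E l' y = 0.
  move=> l'l; rewrite /y linearB Ex // linear_sum big1 ?subr0 // => i /eqP fi.
  have [_ _ _ h _] := hf i (ltn_ord i).
  by rewrite linearZ /= h ?scaler0 // fi.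
have Eyort i : (i < j)%N -> (f i).2 = l -> inner (E l y) (E l (f i).1) = 0.
  move=> ij fi; rewrite /y linearB linear_sum innerBl inner_suml.
  rewrite (bigD1 (Ordinal ij)) /= ?fi ?eqxx // big1 ?addr0.
    by rewrite linearZ innerZl ort // eqxx mulr1 subrr.
  move=> i' /andP[/eqP fi' ii']; rewrite linearZ innerZl ort //.
  by rewrite (_ : (_ == _) = false) ?mulr0 //; exact: negPf ii'.
have [Ely|Ely] := eqVneq (E l y) 0.
  right; exists y; split=> // l'; rewrite ltnS leq_eqVlt => /orP[/eqP -> //|].
  exact: Ey.
have ny : 0 < l2norm (E l y).
  by rewrite lt_def l2norm_ge0 andbT; apply: contra Ely => /eqP /l2norm_eq0 ->.
left; exists (((l2norm (E l y))^-1)%:C *: y, l); split=> //=.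
- exact: flagZ.
- rewrite mulf_neq0 // eq_complex /= invr_eq0 negb_and gt_eqF //.
- exact: ltnW.
- by move=> l' l'l; rewrite linearZ /= (Ey _ l'l) scaler0.
- move=> _; rewrite linearZ /=; split.
    by rewrite l2normZ normc_real ger0_norm ?invr_ge0 ?l2norm_ge0 // mulVf // gt_eqF.
  by move=> i ij fi; rewrite innerZl Eyort // mulr0.
Qed.

Lemma adapted_basis_exists : exists f, forall j, adapted j f (f j).
Proof.
apply: (@sequential_choice _ ((0 : H), 0%N)); last exact: adapted_step.
move=> j f g a fg [h1 h2 h3 h4 h5]; split=> // aN.
have [h6 h7] := h5 aN; split=> // i ij; rewrite -fg //; exact: h7.
Qed.

Section consequences.
Variable f : nat -> H * nat.
Hypothesis fP : forall j, adapted j f (f j).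
Local Notation w j := (f j).1.
Local Notation k j := (f j).2.

Lemma adapted_orthonormal i j : (k i < N)%N -> (k j < N)%N ->
  inner (E (k i) (w i)) (E (k j) (w j)) = (i == j)%:R.
Proof.
move=> ki kj.
have [kij|kij] := eqVneq (k i) (k j); last first.
  rewrite E_sa E_orth // inner0r; case: eqVneq => // ij.
  by rewrite ij eqxx in kij.
case: (ltngtP i j) => [ij|ij|<-].
- have [_ _ _ _ /(_ kj)[_ h]] := fP j.
  by rewrite innerC kij h // conjC0.
- have [_ _ _ _ /(_ ki)[_ h]] := fP i.
  by rewrite -kij h.
- have [_ _ _ _ /(_ ki)[h _]] := fP i.
  by rewrite inner_diag h expr1n.
Qed.

Lemma adapted_span j x : flag j x ->
  exists c : nat -> C, x = \sum_(i < j) c i *: w i.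
Proof.
elim: j x => [|j IH] x hx.
  by exists (fun=> 0); rewrite big_ord0 (flag0 hx).
have [fw wj _ _ _] := fP j.
have [c hc] := IH _ (flagS_reduce hx fw wj).
exists (fun i => if i == j then x j / w j j else c i).
rewrite big_ord_recr /= eqxx -[LHS](subrK ((x j / w j j) *: w j)) hc.
by congr (_ + _); apply: eq_bigr => i _; rewrite ltn_eqF.
Qed.

(** At level [N] every [E l] kills [w j], hence so does [P]; since coordinate [j] of [w j] is
    nonzero, [P (w j) = 0] can be solved for [P (e j)]. *)
Lemma adapted_top_dep (P : l2op R) j :
  (forall x, (forall l, (l < N)%N -> E l x = 0) -> P x = 0) -> k j = N ->
  lspan [set P (e i) | i in [set i | (i < j)%N]] (P (e j)).
Proof.
move=> hP kj; have [fw wj _ Ew _] := fP j.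
have Pw : P (w j) = 0 by apply: hP => l lN; apply: Ew; rewrite kj.
have : w j j *: P (e j) = - \sum_(i < j) w j i *: P (e i).
  have PwE : P (w j) = \sum_(i < j) w j i *: P (e i) + w j j *: P (e j).
    rewrite {1}(flag_trunc fw) linear_sum big_ord_recr /=.
    by congr (_ + _); [apply: eq_bigr => i _|]; rewrite linearZ.
  by apply/eqP; rewrite -addr_eq0 addrC -PwE Pw.
move=> /(congr1 ( *:%R (w j j)^-1)); rewrite scalerA mulVf // scale1r => ->.
apply: lspanZ; rewrite -scaleN1r; apply: lspanZ; apply: lspan_sum => i _.
by apply: lspanZ; apply: lspan_mem; exists (i : nat) => /=.
Qed.

Section rate.
Variables (T : l2op R) (Q Rs : nat -> l2op R) (lam : nat -> C) (r : R).
Hypotheses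
  (uQ : forall n, unitary_op (Q n))
  (TQR : forall n x, iter n T x = Q n (Rs n x))
  (Rs_flag : forall n j x, flag j x -> flag j (Rs n x))
  (Rs_inj : forall n, injective (Rs n))
  (r0 : 0 <= r) (r1 : r < 1)
  (lam0 : forall l, (l < N)%N -> lam l != 0)
  (TE : forall l x, (l < N)%N -> T (E l x) = lam l *: E l x)
  (ET : forall l x, (l < N)%N -> E l (T x) = lam l *: E l x)
  (lead : forall l x n, (l < N)%N -> (forall l', (l' < l)%N -> E l' x = 0) ->
    l2norm (iter n T x - lam l ^+ n *: E l x) <=
      (r * normc (lam l)) ^+ n * l2norm x).

Lemma iter_linear n : linear (iter n T).
Proof. by elim: n => // n IH a x y; rewrite !iterS IH linearP. Qed.

Let iterT n : l2op R := mk_l2op (iter_linear n).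

Lemma near_expr_le (c : R) : 0 < c -> \forall n \near \oo, r ^+ n <= c.
Proof.
move=> c0; have /cvgrPdist_lt/(_ _ c0) : GRing.exp r n @[n --> \oo] --> (0 : R).
  by apply: cvg_expr; rewrite ger0_norm.
by apply: filterS => n; rewrite sub0r normrN ger0_norm ?exprn_ge0 // => /ltW.
Qed.

Lemma Q_basis_rate j : (k j < N)%N ->
  exists2 K : R, 0 <= K & \forall n \near \oo,
    exists a : C, l2norm (Q n (e j) - a *: E (k j) (w j)) <= K * r ^+ n.
Proof.
move=> kj.
pose W : R := \sum_(i < j.+1) l2norm (w i).
have W0 : 0 <= W by apply: sumr_ge0 => i _; exact: l2norm_ge0.
(* The constant of [perturbed_orthonormal], to be applied with [s = r ^+ n]. *)
pose K := 2 * ((j.+1%:R * (W + 2 * j.+1%:R * W)) * (1 + W) + 2 * j.+1%:R * W).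
exists K; first by rewrite /K !(mulr_ge0, addr_ge0).
(* Below this threshold for [r ^+ n] the smallness assumption of [perturbed_orthonormal] holds;
   [W + 1] makes the denominator positive. *)
have c0 : 0 < (2 * (j.+1%:R * (W + 1)))^-1 :> R.
  by rewrite invr_gt0 !mulr_gt0 // ltr_wpDl.
apply: filterS (near_expr_le c0) => n hn.
(* [e j = R_n v] turns [Q_n e_j] into [T^n v], where [v] is a combination of [w_0, ..., w_j]. *)
have [v fv Rv] := flag_surjective (@Rs_inj n) (@Rs_flag n) (@flag_basis R j).
have [c hc] := adapted_span fv.
pose G : pred nat := fun i => (k i < N)%N.
have QE : Q n (e j) = \sum_(i < j.+1) c i *: iterT n (w i).
  rewrite -Rv -TQR hc -[LHS]/(iterT n _) linear_sum.
  by apply: eq_bigr => i _; rewrite linearZ.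
pose g i := E (k i) (w i).
pose h i := (lam (k i) ^+ n)^-1 *: iterT n (w i) - g i.
pose a i := c i * lam (k i) ^+ n.
pose F : H := \sum_(i < j.+1 | ~~ G i) c i *: iterT n (w i).
have lamn i : G i -> lam (k i) ^+ n != 0 by move=> Gi; rewrite expf_neq0 // lam0.
have gh i : G i -> g i + h i = (lam (k i) ^+ n)^-1 *: iterT n (w i).
  by move=> _; rewrite /h addrC subrK.
(* [T^n w_i = Q_n R_n w_i], and [R_n w_i] lies in [flag j], so its coordinate [j] is 0. *)
have yort i : (i < j)%N -> inner (Q n (e j)) (iterT n (w i)) = 0.
  move=> ij; rewrite [iterT n _]TQR unitary_inner // inner_basisl.
  have [fw _ _ _ _] := fP i.
  by rewrite (Rs_flag n (flagW ij fw)) // conjC0.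
exists (a j).
apply: (@perturbed_orthonormal _ j g h G a F).
- rewrite QE (bigID (fun i : 'I_j.+1 => G i)) /=; congr (_ + _).
  by apply: eq_bigr => i Gi; rewrite gh // scalerA mulfK // lamn.
- by rewrite unitary_l2norm // l2norm_basis.
- exact: kj.
- by move=> i l; exact: adapted_orthonormal.
- move=> i ij Gi.
  have -> : h i = (lam (k i) ^+ n)^-1 *: (iter n T (w i) - lam (k i) ^+ n *: g i).
    by rewrite scalerBr scalerA mulVf ?scale1r // lamn.
  have lp : 0 < normc (lam (k i) ^+ n).
    by rewrite lt_def Defs.normc_ge0 andbT normc_eq0 lamn.
  rewrite l2normZ normcV ler_pdivrMl //.
  have [_ _ _ Ew _] := fP i.
  apply: le_trans (lead n Gi Ew) _; rewrite exprMn normcX mulrAC.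
  rewrite [leRHS]mulrC ler_wpM2r ?exprn_ge0 ?Defs.normc_ge0 //.
  rewrite mulrC ler_wpM2r ?exprn_ge0 // /W (bigD1 (Ordinal ij)) //= lerDl.
  by apply: sumr_ge0 => l _; exact: l2norm_ge0.
- by [].
- exact: exprn_ge0.
- by rewrite exprn_ile1 // ltW.
- apply: (@le_trans _ _ (j.+1%:R * ((W + 1) * (2 * (j.+1%:R * (W + 1)))^-1))).
    rewrite ler_wpM2l // ler_pM ?exprn_ge0 // lerDl //.
  rewrite mulrA invfM mulrCA divff ?mulr1 ?div1r //.
  by rewrite mulf_neq0 // gt_eqF // ltr_wpDl.
(* [E (k i)] kills the vectors of level [N] and, commuting with [T] up to the scalar action, also
   their images under [T^n]. *)
- move=> i Gi; rewrite /F inner_suml big1 // => l nGl.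
  have kl : k l = N.
    by have [_ _ kN _ _] := fP l; apply/eqP; rewrite eqn_leq kN leqNgt.
  have EwN : E (k i) (w l) = 0.
    by have [_ _ _ Ew _] := fP l; apply: Ew; rewrite kl.
  have EiT m : E (k i) (iter m T (w l)) = 0.
    by elim: m => [//|m IH]; rewrite iterS ET // IH scaler0.
  by rewrite innerZl /g -E_sa [iterT n _]/(iter n T _) EiT inner0l mulr0.
- by move=> i ij Gi; rewrite gh // innerZr yort // mulr0.
- rewrite /F inner_sumr big1 // => i nGi; rewrite innerZr yort ?mulr0 //.
  have : (i <= j)%N by rewrite -ltnS.
  by rewrite leq_eqVlt => /orP[/eqP ij|//]; move: nGi; rewrite ij /G kj.
Qed.

Hypothesis bT : bounded_op T.

(** [T - lam (k j)] annihilates [E (k j) (w j)], so applied to [Q_n e_j] it only sees the error of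
    [Q_basis_rate], whatever the coefficient [a]. *)
Lemma qtq_basis_rate j : (k j < N)%N ->
  exists2 K : R, 0 <= K & \forall n \near \oo,
    l2norm (qtq T Q n (e j) - lam (k j) *: e j) <= K * r ^+ n.
Proof.
move=> kj; have [K K0 hK] := Q_basis_rate kj; have [c c0 hc] := bounded_opP bT.
have cl0 : 0 <= c + normc (lam (k j)) by rewrite addr_ge0 ?Defs.normc_ge0.
exists ((c + normc (lam (k j))) * K); first exact: mulr_ge0.
apply: filterS hK => n [a ha].
have [_ QK _] := uQ n.
have -> : qtq T Q n (e j) - lam (k j) *: e j =
    adj (Q n) (T (Q n (e j)) - lam (k j) *: Q n (e j)).
  by rewrite [in RHS]linearB [adj _ (_ *: _)]linearZ /= QK.
rewrite unitary_adj_l2norm //; set d := Q n (e j) - _ in ha.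
have -> : T (Q n (e j)) - lam (k j) *: Q n (e j) = T d - lam (k j) *: d.
  have -> : T d = T (Q n (e j)) - lam (k j) *: (a *: E (k j) (w j)).
    by rewrite /d linearB [T (a *: _)]linearZ /= TE // !scalerA mulrC.
  by rewrite /d scalerBr opprB addrA subrK.
rewrite -mulrA; apply: (@le_trans _ _ ((c + normc (lam (k j))) * l2norm d)).
  by rewrite mulrDl; apply: le_trans (l2normB _ _) _; rewrite lerD // l2normZ.
by rewrite ler_wpM2l.
Qed.

(** With [g = E (k j) (w j)], the properties of [E] give [inner (T y) g = lam (k j) * inner y g].
    Subtracting [a *: g] from [Q_n e_j] therefore does not change the pairing with
    [lam (k j) *: Q_n x - T (Q_n x)]. *)
Lemma qtq_row_cvg j x : (k j < N)%N ->
  inner (qtq T Q n x) (e j) @[n --> \oo] --> lam (k j) * inner x (e j).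
Proof.
move=> kj; have [K K0 hK] := Q_basis_rate kj; have [c c0 hc] := bounded_opP bT.
have cl0 : 0 <= c + normc (lam (k j)) by rewrite addr_ge0 ?Defs.normc_ge0.
pose B := (c + normc (lam (k j))) * l2norm x * K.
apply/cvg_normcP; apply: (@squeeze_cvgr _ _ _ _ (fun=> 0) (fun n => B * r ^+ n)).
- apply: filterS hK => n [a ha]; rewrite Defs.normc_ge0 /=.
  set g := E (k j) (w j) in ha; set l := lam (k j).
  have Tg y : inner (T y) g = l * inner y g.
    by rewrite /g -!E_sa ET // innerZl.
  have -> : l * inner x (e j) - inner (qtq T Q n x) (e j) =
      inner (l *: Q n x - T (Q n x)) (Q n (e j) - a *: g).
    rewrite /qtq adjP2; last by have [] := uQ n.
    rewrite -[in LHS](unitary_inner x (e j) (uQ n)) innerBr !innerBl !innerZl.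
    by rewrite !innerZr Tg; ring.
  apply: le_trans (cauchy_schwarz _ _) _; rewrite /B -[leRHS]mulrA.
  apply: ler_pM; rewrite ?l2norm_ge0 //; apply: le_trans (l2normB _ _) _.
  rewrite mulrDl addrC; apply: lerD.
    by rewrite -(unitary_l2norm x (uQ n)).
  by rewrite l2normZ unitary_l2norm.
- exact: cvg_cst.
- rewrite -(mulr0 B); apply: cvgM; first exact: cvg_cst.
  by apply: cvg_expr; rewrite ger0_norm.
Qed.

End rate.
End consequences.
End adapted_basis.

(** * Dimension counts and the subset e^_j *)

Section dimension.
Variable R : realType.
Local Notation C := (R[i]).
Local Notation H := (l2 R).
Local Notation e := (@l2_basis R).

Lemma lspan_below (u : nat -> H) k x : lspan (u @` below (Some k)) x ->
  exists c : 'I_k -> C, x = \sum_(i < k) c i *: u i.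
Proof.
apply: (lspan_min (V := [set x | exists c : 'I_k -> C, x = \sum_(i < k) c i *: u i])).
- by exists (fun=> 0); rewrite big1 // => i _; rewrite scale0r.
- move=> a y z [c ->] [c' ->]; exists (fun i => a * c i + c' i).
  rewrite scaler_sumr -big_split; apply: eq_bigr => i _ /=.
  by rewrite scalerA -scalerDl.
- move=> _ [i /= ik <-]; exists (fun l => (l == Ordinal ik)%:R).
  rewrite (bigD1 (Ordinal ik)) //= eqxx scale1r big1 ?addr0 // => l li.
  by rewrite (negPf li) scale0r.
Qed.

Lemma below_in (a : enat) j : below a j -> j \in below a.
Proof. exact: mem_set. Qed.

(** If [k < n], the [n] by [k] coefficient matrix has a nonzero vector in its left kernel, which is
    a linear relation between the [v j]. *)
Lemma lin_indep_le_span n k (v u : nat -> H) :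
  lin_indep (below (Some n)) v ->
  (forall j, (j < n)%N -> lspan (u @` below (Some k)) (v j)) -> (n <= k)%N.
Proof.
move=> vi vu; rewrite leqNgt; apply/negP => kn.
have /choice[A hA] : forall j : 'I_n, exists c : 'I_k -> C,
    v j = \sum_(i < k) c i *: u i.
  by move=> j; apply: lspan_below; exact: vu.
pose M : 'M[C]_(n, k) := \matrix_(j, i) A j i.
have : kermx M != 0.
  by rewrite -mxrank_eq0 mxrank_ker -lt0n subn_gt0 (leq_ltn_trans (rank_leq_col M)).
case/rowV0Pn => a /sub_kermxP aM a0.
pose c (j : nat) : C := if insub j is Some o then a 0 o else 0.
have cE (o : 'I_n) : c o = a 0 o by rewrite /c valK.
have : \sum_(j < n | (j : nat) \in below (Some n)) c j *: v j = 0.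
  rewrite (eq_bigl predT); last by move=> j; apply: below_in; exact: (ltn_ord j).
  rewrite (eq_bigr (fun j => \sum_(i < k) (a 0 j * A j i) *: u i)); last first.
    by move=> j _; rewrite cE hA scaler_sumr; apply: eq_bigr => i _; rewrite scalerA.
  rewrite exchange_big big1 // => i _ /=; rewrite -scaler_suml.
  have /matrixP/(_ 0 i) := aM; rewrite !mxE => aMi.
  rewrite (_ : \sum_(j < n) _ = 0) ?scale0r // -[RHS]aMi.
  by apply: eq_bigr => j _; rewrite mxE.
move=> /vi c0; move/eqP: a0; apply; apply/matrixP => i j.
by rewrite !mxE (ord1 i) -cE c0 ?ltn_ord //; exact: (ltn_ord j).
Qed.

(** The list [s] renumbers [B] by an initial segment, as [lin_indep_le_span] expects; orthonormality
    supplies the independence. *)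
Lemma orthonormal_card_le (M d : nat) (q : nat -> H) (V : set H)
    (B : pred 'I_M) :
  (forall i j, (i < M)%N -> (j < M)%N -> inner (q i) (q j) = (i == j)%:R) ->
  (forall j, j \in B -> V (q j)) -> has_dim V (Some d) -> (#|B| <= d)%N.
Proof.
move=> ort BV [u [_ VE]].
pose s := [seq val x | x <- enum B].
have us : uniq s by rewrite map_inj_uniq ?enum_uniq //; exact: val_inj.
have ss : size s = #|B| by rewrite size_map -cardE.
have sP i : (i < #|B|)%N -> exists2 j : 'I_M, j \in B & nth 0%N s i = j.
  rewrite -ss => si; have /mapP[j jB ->] := mem_nth 0%N si.
  by exists j; rewrite mem_enum in jB.
apply: (@lin_indep_le_span _ _ (fun i => q (nth 0%N s i)) u); last first.
  by move=> i /sP[j jB ->]; rewrite -VE; exact: BV.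
move=> n c sum0 l ln lB.
have lB' : (l < #|B|)%N by [].
have : inner (\sum_(j < n | (j : nat) \in below (Some #|B|)) c j *: q (nth 0%N s j))
  (q (nth 0%N s l)) = 0 by rewrite sum0 inner0l.
rewrite inner_suml (bigD1 (Ordinal ln)) /=; last exact: below_in.
have nthM i : (i < #|B|)%N -> (nth 0%N s i < M)%N by move=> /sP[j _ ->].
rewrite innerZl ort ?nthM // eqxx mulr1 big1 ?addr0 // => j /andP[/set_mem jB jl].
have jB' : (j < #|B|)%N by [].
rewrite innerZl ort ?nthM // nth_uniq ?ss // (_ : (_ == _) = false) ?mulr0 //.
exact: negPf jl.
Qed.

End dimension.

(** * Reordering by eigenvalue *)

Section blocks.
Variable d : nat -> nat.

(** The target order of the levels in the formula for finite [M], with level [l] repeated [d l]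
    times. *)
Fixpoint blocks (n : nat) : seq nat :=
  if n is n'.+1 then blocks n' ++ nseq (d n') n' else [::].

Lemma size_blocks n : size (blocks n) = (\sum_(l < n) d l)%N.
Proof.
by elim: n => [|n IH]; rewrite ?big_ord0 // big_ord_recr /= size_cat size_nseq IH.
Qed.

Lemma count_blocks n k : count_mem k (blocks n) = if (k < n)%N then d k else 0%N.
Proof.
elim: n => [//|n IH]; rewrite /= count_cat IH count_nseq ltnS /=.
by case: (ltngtP n k) => [nk|nk|->]; rewrite ?mul0n ?mul1n ?addn0.
Qed.

Lemma leq_sum_ord n k : (n <= k)%N -> (\sum_(l < n) d l <= \sum_(l < k) d l)%N.
Proof.
move=> /subnK <-; elim: (k - n)%N => // m IH.
by rewrite addSn big_ord_recr /=; apply: leq_trans IH _; exact: leq_addr.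
Qed.

Lemma nth_blocks n k j : (k < n)%N -> (j < size (blocks n))%N ->
  (nth 0%N (blocks n) j == k) =
  (\sum_(l < k) d l <= j < \sum_(l < k.+1) d l)%N.
Proof.
elim: n => [//|n IH]; rewrite ltnS => kn jn /=; rewrite nth_cat.
case: ltnP => [jlt|jge].
  move: kn; rewrite leq_eqVlt => /orP[/eqP ->|kn]; last exact: IH.
  rewrite -size_blocks leqNgt jlt /=; apply/negbTE/eqP => E.
  have := mem_nth 0%N jlt; rewrite E -has_pred1 has_count count_blocks ltnn.
  by [].
move: jn; rewrite /= size_cat size_nseq => jn.
rewrite nth_nseq -(ltn_add2l (size (blocks n))) subnKC // jn.
move: kn; rewrite leq_eqVlt => /orP[/eqP ->|kn].
  by rewrite eqxx big_ord_recr /= -size_blocks jge.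
rewrite gtn_eqF //; apply/esym/negbTE; rewrite negb_and -!leqNgt; apply/orP; right.
by apply: leq_trans jge; rewrite size_blocks; exact: leq_sum_ord.
Qed.

(** Equal totals turn the bounds on the counts into equalities, so the list of values of [kappa] is
    a rearrangement of [blocks N], where [nth_blocks] locates each level. *)
Lemma block_perm (M N : nat) (kappa : 'I_M -> nat) :
  (forall j, (kappa j < N)%N) -> (\sum_(l < N) d l)%N = M ->
  (forall k, (k < N)%N -> (#|[pred j | kappa j == k]| <= d k)%N) ->
  exists s : 'S_M, forall (j : 'I_M) k, (k < N)%N ->
    (kappa (s j) == k) = (\sum_(l < k) d l <= j < \sum_(l < k.+1) d l)%N.
Proof.
move=> kN sumd cardle.
have cardE k : (k < N)%N -> #|[pred j | kappa j == k]| = d k.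
  move=> kN'.
  have sumc : (\sum_(l < N) #|[pred j | kappa j == l]|)%N = M.
    under eq_bigr => l _ do rewrite -sum1_card.
    rewrite (exchange_big_dep predT) //= -[RHS](card_ord M) -sum1_card.
    apply: eq_bigr => j _; rewrite (bigD1 (Ordinal (kN j))) ?inE //= big1 //.
    move=> l /andP[]; rewrite inE => /eqP kl /eqP lj; case: lj.
    by apply: val_inj; rewrite /= kl.
  have [_] := leqif_sum (fun (l : 'I_N) (_ : true) => leqif_eq (cardle l (ltn_ord l))).
  rewrite sumc sumd eqxx => /esym/forallP/(_ (Ordinal kN')) /=.
  by move/eqP.
have sb : size (blocks N) == M by rewrite size_blocks sumd.
have : perm_eq (Tuple sb) [tuple kappa j | j < M].
  apply/allP => x _ /=; rewrite count_blocks; apply/eqP.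
  rewrite count_map -sum1_count big_enum_cond /= sum1dep_card.
  transitivity #|[pred j | kappa j == x]|; last first.
    by apply: eq_card => j; rewrite !inE.
  case: ltnP => xN; first by rewrite cardE.
  apply/esym/eq_card0 => j; rewrite !inE.
  by rewrite ltn_eqF // (leq_trans (kN j)).
case/tuple_permP => s sE; exists s => j k kN'.
have jb : (j < size (blocks N))%N by rewrite (eqP sb).
rewrite -(nth_blocks kN' jb); congr (_ == _).
have -> : blocks N = [tuple tnth [tuple kappa j | j < M] (s i) | i < M] := sE.
by rewrite -[j in nth _ _ j]/(val j) -tnth_nth !tnth_mktuple.
Qed.

End blocks.

Lemma enat_sum_Some (N M : nat) (m : nat -> enat) :
  \big[enat_add/Some 0%N]_(i < N) m i = Some M ->
  (forall i, (i < N)%N -> m i = Some (odflt 0%N (m i))) /\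
  (\sum_(i < N) odflt 0%N (m i))%N = M.
Proof.
elim: N m M => [|N IH] m M; first by rewrite !big_ord0 => -[<-].
rewrite !big_ord_recl /=; case E : (m 0%N) => [a|//].
case E' : (\big[enat_add/Some 0%N]_(i < N) _) => [b|//] [<-].
have [h1 h2] := IH (fun i => m i.+1) b E'; split.
  by case=> [_|i iN]; [rewrite E | exact: h1].
by rewrite -h2 /=.
Qed.

(** * The indices of the e^_j, and the gap between lines *)

Section hat_basis.
Variable R : realType.
Local Notation C := (R[i]).
Local Notation H := (l2 R).
Local Notation e := (@l2_basis R).

Lemma below_leq (M : enat) i j : (i <= j)%N -> below M j -> below M i.
Proof. by case: M => // M ij; exact: leq_ltn_trans. Qed.

Lemma lin_indep_not_dep (M : enat) (v : nat -> H) i : lin_indep (below M) v ->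
  below M i -> ~ lspan [set v l | l in [set l | (l < i)%N]] (v i).
Proof.
move=> vi Mi /lspan_below[c vE].
(* [insub] fails from [l = i] on, and the default [-1] is the coefficient of [v i] itself. *)
pose c' (l : nat) : C := if insub l is Some o then c o else -1.
have : \sum_(l < i.+1 | (l : nat) \in below M) c' l *: v l = 0.
  rewrite (eq_bigl predT); last first.
    by move=> l; apply: below_in; apply: below_leq Mi; rewrite -ltnS.
  rewrite big_ord_recr /= {2}/c' insubF ?ltnn // scaleN1r vE.
  apply/eqP; rewrite subr_eq0; apply/eqP; apply: eq_bigr => l _.
  by rewrite /c' valK.
move=> /vi/(_ i (ltnSn i) Mi); rewrite /c' insubF ?ltnn // => /eqP.
by rewrite oppr_eq0 oner_eq0.
Qed.

(** As [p] is increasing, [j <= p j], so the index [i] with [p i = j] is at most [j]; if [i < j],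
    induction would give [p i = i]. *)
Lemma increasing_onto_below (M : enat) (p : nat -> nat) :
  (forall i j, below M j -> (i < j)%N -> (p i < p j)%N) ->
  below M `<=` p @` below M -> forall j, below M j -> p j = j.
Proof.
move=> pinc onto.
have pge j : below M j -> (j <= p j)%N.
  elim: j => // j IH Mj; apply: leq_ltn_trans (pinc j j.+1 Mj (ltnSn j)).
  by apply: IH; exact: below_leq Mj.
elim/ltn_ind => j IH Mj; have [i Mi pij] := onto j Mj.
have ij : (i <= j)%N by rewrite -pij pge.
move: ij; rewrite leq_eqVlt => /orP[/eqP ij|ij]; first by rewrite -{1}ij.
by have := IH i ij Mi; rewrite pij => ji; rewrite ji ltnn in ij.
Qed.

Lemma hat_enum_lin_indep (P : l2op R) (M : enat) (p : nat -> nat) :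
  hat_enum P M p -> lin_indep (below M) (fun l => P (e l)) ->
  forall j, below M j -> p j = j.
Proof.
case=> K [[good _] pinc pE] vi; apply: increasing_onto_below => // i Mi.
rewrite pE; have ndep := lin_indep_not_dep vi Mi.
have Pe0 : P (e i) != 0.
  by apply/eqP => Pei; apply: ndep; rewrite Pei; exact: lspan0.
(* If [K] were a finite [k <= i], then [k] vectors would span [M > k] independent ones when [M] is
   finite, and [k.+1] of them when it is not. *)
have Ki : below K i.
  case: K good {pE} => [k|//] /= good; apply: contrapT => /negP.
  rewrite -leqNgt => ki.
  case: M Mi good {vi ndep pinc} => [M|] Mi /= good.
    have [v [vi vE]] := good; have : (M <= k)%N.
      apply: (lin_indep_le_span vi (u := fun j => P (e j))) => j jM.
      by rewrite vE; apply: lspan_mem; exists j.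
    by move=> /(leq_trans Mi); rewrite ltnNge ki.
  have [v [vi vE]] := good k.+1; have : (k.+1 <= k)%N.
    apply: (lin_indep_le_span vi (u := fun j => P (e j))) => j jM.
    by apply: vE; exists j.
  by rewrite ltnn.
by split=> // -[_ ]; exact: ndep.
Qed.

Lemma opnorm_ge (F : H -> H) (B : R) x :
  (forall x, l2norm x <= 1 -> l2norm (F x) <= B) -> l2norm x <= 1 ->
  l2norm (F x) <= opnorm F.
Proof.
move=> FB x1; apply: ub_le_sup; last by exists x.
by exists B => _ [y y1 <-]; exact: FB.
Qed.

Lemma opnorm_le (F : H -> H) (B : R) :
  (forall x, l2norm x <= 1 -> l2norm (F x) <= B) -> opnorm F <= B.
Proof.
move=> FB; apply: ge_sup; first by exists (l2norm (F 0)), 0 => //=; rewrite l2norm0.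
by move=> _ [y y1 <-]; exact: FB.
Qed.

(** The difference of the two projections is evaluated at [v]; the bound 2 makes the supremum in
    [opnorm] finite. *)
Lemma gap_line_ge (v q : H) : l2norm v = 1 -> l2norm q = 1 ->
  l2norm (v - inner v q *: q) <= gap (lspan [set v]) (lspan [set q]).
Proof.
move=> v1 q1; rewrite /gap.
set F := (fun x => _).
have FE x : F x = inner x v *: v - inner x q *: q by rewrite /F !orthoproj_line.
have -> : v - inner v q *: q = F v by rewrite FE inner_diag v1 expr1n scale1r.
apply: (@opnorm_ge _ 2); last by rewrite v1.
move=> x x1; rewrite FE; apply: le_trans (l2normB _ _) _; rewrite -[2]/(1 + 1).
have b1 u : l2norm u = 1 -> l2norm (inner x u *: u) <= 1.
  move=> u1; rewrite l2normZ u1 mulr1; apply: le_trans (cauchy_schwarz _ _) _.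
  by rewrite u1 mulr1.
by apply: lerD; exact: b1.
Qed.

End hat_basis.

(** * Limits of Q_n^* T Q_n *)

Section limits.
Variable R : realType.
Local Notation C := (R[i]).
Local Notation H := (l2 R).
Local Notation e := (@l2_basis R).

(** Adjoints replace a density argument: the values of [A] on the basis determine every coordinate
    of [adj A y]. *)
Lemma l2op_ext_basis (A B : l2op R) : bounded_op A -> bounded_op B ->
  (forall j, A (e j) = B (e j)) -> forall x, A x = B x.
Proof.
move=> bA bB AB x; apply: inner_extl => y; rewrite (adjP bA) (adjP bB); congr (inner x _).
apply: l2_ext => j; rewrite -!coord_inner (adjP2 bA) (adjP2 bB).
by rewrite innerC AB -innerC.
Qed.

Lemma cvg_l2_sub0 (u : nat -> H) x :
  u n - x @[n --> \oo] --> (0 : H) -> u n @[n --> \oo] --> x.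
Proof.
move=> /cvg_l2P h; apply/cvg_l2P; rewrite (eq_cvg _ _ (_ : _ =1
  (fun n => l2norm (0 - (u n - x))))) // => n.
by rewrite sub0r opprB.
Qed.

Lemma coord_cvg_flag (u : nat -> H) (x : H) (K : nat) : (forall n, flag K (u n)) ->
  (forall i, u n i @[n --> \oo] --> x i) -> u n @[n --> \oo] --> x.
Proof.
move=> fu ux.
have fx : flag K x.
  move=> i Ki; have h0 : (fun _ : nat => 0 : C) n @[n --> \oo] --> (0 : C).
    exact: cvg_cst.
  by apply: (C_cvg_unique (ux i) h0) => n; exact: fu.
apply/cvg_l2P; apply: (@cvg0_le _ (fun n => \sum_(i < K) normc (x i - u n i))).
- by move=> n; exact: l2norm_ge0.
- move=> n; have fxu : flag K (x - u n) by exact: flagB.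
  rewrite (flag_trunc fxu); apply: le_trans (l2norm_sum _ _ _) _.
  by apply: ler_sum => i _; rewrite l2normZ l2norm_basis mulr1.
- by apply: cvg_sum0 => i; have /cvg_normcP := ux i.
Qed.

Lemma cvg_le_expr (r K : R) (u : nat -> R) : 0 <= r -> r < 1 ->
  (forall n, 0 <= u n) -> (\forall n \near \oo, u n <= K * r ^+ n) ->
  u n @[n --> \oo] --> (0 : R).
Proof.
move=> r0 r1 u0 uK; apply: (@squeeze_cvgr _ _ _ _ (fun=> 0) (fun n => K * r ^+ n)).
- by apply: filterS uK => n ->; rewrite u0.
- exact: cvg_cst.
- rewrite -(mulr0 K); apply: cvgM; first exact: cvg_cst.
  by apply: cvg_expr; rewrite ger0_norm.
Qed.

Lemma expr_bound_eqO (r K : R) (u : nat -> R) : 0 <= r -> 0 <= K ->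
  (forall n, 0 <= u n) -> (\forall n \near \oo, u n <= K * r ^+ n) ->
  u =O_\oo (fun n => r ^+ n).
Proof.
move=> r0 K0 u0 uK; apply/eqO_exP; exists (K + 1); first by rewrite ltr_wpDl.
apply: filterS uK => n h; rewrite !ger0_norm ?exprn_ge0 //.
by apply: le_trans h _; rewrite ler_wpM2r ?exprn_ge0 // lerDl.
Qed.

Section diagonal_limit.
Variables (T : l2op R) (Q : nat -> l2op R) (J : set nat) (lv : nat -> C).
Variables (r cl : R).
Hypotheses (bT : bounded_op T) (uQ : forall n, unitary_op (Q n))
  (r0 : 0 <= r) (r1 : r < 1) (cl0 : 0 <= cl)
  (lv_le : forall i, J i -> normc (lv i) <= cl)
  (rate : forall i, J i -> exists2 K : R, 0 <= K &
    \forall n \near \oo, l2norm (qtq T Q n (e i) - lv i *: e i) <= K * r ^+ n)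
  (row : forall i x, J i ->
    inner (qtq T Q n x) (e i) @[n --> \oo] --> lv i * inner x (e i)).

Definition limit_coef i : C := if i \in J then lv i else 0.

Lemma limit_coef_le i : normc (limit_coef i) <= cl.
Proof.
rewrite /limit_coef; case: (boolP (i \in J)) => [/set_mem|_]; first exact: lv_le.
by rewrite [normc _]normc0.
Qed.

(** Defined by coordinates, which makes it bounded at once; [limit_diag_op_sum] recovers the sum
    over the e^_j. *)
Definition limit_diag : l2op R := diag_op cl0 limit_coef_le.

Lemma limit_diag_bounded : bounded_op limit_diag.
Proof. by exists cl => x; exact: diag_op_le. Qed.

Lemma limit_diag_basis i : J i -> limit_diag (e i) = lv i *: e i.
Proof. by move=> Ji; rewrite diag_op_basis /limit_coef mem_set. Qed.

Lemma limit_diag_basis0 i : ~ J i -> limit_diag (e i) = 0.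
Proof. by move=> Ji; rewrite diag_op_basis /limit_coef memNset // scale0r. Qed.

Lemma qtq_basis_cvg i : J i -> qtq T Q n (e i) @[n --> \oo] --> limit_diag (e i).
Proof.
move=> Ji; rewrite limit_diag_basis //; have [K K0 hK] := rate Ji.
apply/cvg_l2P; apply: (cvg_le_expr r0 r1 (K := K)) => [n|]; first exact: l2norm_ge0.
by apply: filterS hK => n; rewrite l2norm_distC.
Qed.

Lemma qtq_bound : exists2 c : R, 0 <= c &
  forall n x, l2norm (qtq_op T Q n x) <= c * l2norm x.
Proof. by have [c c0 hc] := bounded_opP bT; exists c => // n x; exact: qtq_le. Qed.

Definition section_error n : l2op R :=
  coord_proj J \o qtq_op T Q n \o coord_proj J \- limit_diag.

Lemma section_errorE n x : section_error n x =
  coord_proj J (qtq T Q n (coord_proj J x)) - limit_diag x.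
Proof. by []. Qed.

Lemma section_error_basis0 n i : ~ J i -> section_error n (e i) = 0.
Proof.
move=> Ji; rewrite section_errorE limit_diag_basis0 // coord_proj_basis memNset //.
by rewrite subr0 -[qtq T Q n 0]/(qtq_op T Q n 0) !linear0.
Qed.

Lemma section_error_basis_le n i : J i ->
  l2norm (section_error n (e i)) <= l2norm (qtq T Q n (e i) - lv i *: e i).
Proof.
move=> Ji; rewrite section_errorE coord_proj_basis mem_set // limit_diag_basis //.
have {1}-> : lv i *: e i = coord_proj J (lv i *: e i).
  by rewrite [in RHS]linearZ coord_proj_basis mem_set.
by rewrite -linearB coord_proj_le.
Qed.

Lemma section_sot_cvg :
  sot_cvg (fun n x => coord_proj J (qtq T Q n (coord_proj J x))) limit_diag.
Proof.
move=> x; apply: cvg_l2_sub0; have [c c0 hc] := qtq_bound.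
apply: (@sot_dense0 _ section_error (c + cl)) => [|n y|i]; first exact: addr_ge0.
  rewrite section_errorE mulrDl; apply: le_trans (l2normB _ _) _; apply: lerD.
    apply: le_trans (coord_proj_le _ _) _; apply: le_trans (hc n _) _.
    by rewrite ler_wpM2l // coord_proj_le.
  exact: diag_op_le.
have [Ji|Ji] := pselect (J i); last first.
  rewrite (eq_cvg _ _ (_ : _ =1 (fun=> 0))) ?section_error_basis0 //.
    exact: cvg_cst.
  by move=> n; rewrite section_error_basis0.
have [K K0 hK] := rate Ji.
apply/cvg_l2P; apply: (cvg_le_expr r0 r1 (K := K)) => [n|]; first exact: l2norm_ge0.
apply: filterS hK => n; rewrite sub0r l2normN; apply: le_trans.
exact: section_error_basis_le.
Qed.

Lemma section_rate x : lspan [set e i | i in J] x ->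
  exists2 K : R, 0 <= K &
    \forall n \near \oo, l2norm (section_error n x) <= K * r ^+ n.
Proof.
apply: (lspan_min (V := [set x | exists2 K : R, 0 <= K &
    \forall n \near \oo, l2norm (section_error n x) <= K * r ^+ n])).
- exists 0 => //; apply: nearW => n; rewrite linear0 mul0r.
  by rewrite [l2norm _]l2norm0.
- move=> a y z [K K0 hK] [K' K'0 hK']; exists (normc a * K + K').
    by rewrite addr_ge0 // mulr_ge0 // Defs.normc_ge0.
  apply: filterS2 hK hK' => n h h'; rewrite linearP mulrDl.
  apply: le_trans (l2normD _ _) _; apply: lerD => //.
  by rewrite l2normZ -mulrA ler_wpM2l // Defs.normc_ge0.
- move=> _ [i Ji <-]; have [K K0 hK] := rate Ji; exists K => //.
  by apply: filterS hK => n; apply: le_trans; exact: section_error_basis_le.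
Qed.

(** The weak limit [B] of a subsequence is split by columns: [S] is [B] on the coordinates outside
    [J], and [xi j] is [B (e j)]. The known columns force [B] to agree with [limit_diag] on [J]; the
    known rows force [xi j] to vanish there. *)
Lemma weak_limit (phi : nat -> nat) : {homo phi : i j / (i < j)%N} ->
  exists psi : nat -> nat, {homo psi : i j / (i < j)%N} /\
  exists (xi : nat -> H) (S : l2op R),
    [/\ forall j, ~ J j -> closure (lspan [set e i | i in [set i | ~ J i]]) (xi j),
        bounded_op S /\
        is_op_sum [set i | ~ J i] (fun j => rank_one (xi j) (e j)) S,
        wot_cvg (fun k => qtq T Q (phi (psi k))) (fun x => limit_diag x + S x) &
        (forall j, exists K, forall n, flag K (qtq T Q n (e j))) ->
          sot_cvg (fun k => qtq T Q (phi (psi k))) (fun x => limit_diag x + S x)].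
Proof.
move=> phi_mono; have [c c0 hc] := qtq_bound.
have [psi [psi_mono [B [hB Bw]]]] := weak_compact c0 (fun n => hc (phi n)).
have mono_ge (f : nat -> nat) : {homo f : i j / (i < j)%N} -> forall n, (n <= f n)%N.
  by move=> fm; elim=> // n IH; apply: leq_ltn_trans IH (fm _ _ (ltnSn n)).
have sub_cvg (U : topologicalType) (u : nat -> U) (l : U) :
    u n @[n --> \oo] --> l -> u (phi (psi n)) @[n --> \oo] --> l.
  move=> ul; apply: cvg_comp ul => A [n _ hn]; exists n => // m nm; apply: hn => /=.
  apply: leq_trans nm _; apply: leq_trans (mono_ge _ psi_mono m) _.
  exact: mono_ge.
pose Th := [set i | ~ J i].
have bB : bounded_op B by exists c.
pose S : l2op R := B \o coord_proj Th.
have bS : bounded_op S.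
  exists c => x; apply: le_trans (hB _) _.
  by rewrite ler_wpM2l // coord_proj_le.
have BJ i : J i -> B (e i) = limit_diag (e i).
  move=> Ji; apply: inner_extl => y.
  apply: (C_cvg_unique (Bw (e i) y) _ (fun=> erefl)).
  exact: inner_cvgl (sub_cvg _ _ _ (qtq_basis_cvg Ji)).
have BE x : B x = limit_diag x + S x.
  pose DS : l2op R := limit_diag \+ S.
  apply: (@l2op_ext_basis B DS) => // [|j].
    have [c1 h1] := limit_diag_bounded; have [c2 h2] := bS.
    exists (c1 + c2) => y; rewrite mulrDl; apply: le_trans (l2normD _ _) _.
    exact: lerD.
  rewrite -[RHS]/(limit_diag (e j) + B (coord_proj Th (e j))) coord_proj_basis.
  have [Jj|nJj] := pselect (J j).
    have nTj : ~ Th j by [].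
    by rewrite memNset // linear0 addr0 BJ.
  by rewrite mem_set // limit_diag_basis0 // add0r.
exists psi; split => //; exists (fun j => B (e j)), S; split.
- move=> j nJj; rewrite closure_basis => i; rewrite /mkset => nTi.
  have Ji : J i by apply: contrapT.
  rewrite -coord_inner.
  have h := sub_cvg _ _ _ (@row i (e j) Ji).
  have -> : inner (B (e j)) (e i) = lv i * inner (e j) (e i).
    exact: (C_cvg_unique (Bw (e j) (e i)) h (fun=> erefl)).
  rewrite coord_inner basisE (_ : (_ == _) = false) ?mulr0 //.
  by apply/eqP => ij; apply: nJj; rewrite -ij.
- split=> // x.
  have h : B (coord_trunc (coord_proj Th x) n) @[n --> \oo] --> S x.
    by apply: bounded_op_cvg => //; exact: coord_trunc_cvg.
  rewrite (eq_cvg _ _ (_ : _ =1 (fun n => B (coord_trunc (coord_proj Th x) n)))) //.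
  move=> n; rewrite -coord_proj_sum linear_sum; apply: eq_bigr => j _.
  by rewrite linearZ /rank_one coord_inner.
- by move=> x y; rewrite -BE; exact: Bw.
- move=> col x; rewrite -BE; apply: cvg_l2_sub0.
  pose G k : l2op R := qtq_op T Q (phi (psi k)) \- B.
  apply: (@sot_dense0 _ G (c + c)) => [|n y|j]; first exact: addr_ge0.
    by rewrite mulrDl; apply: le_trans (l2normB _ _) _; apply: lerD; [exact: hc|exact: hB].
  have [K hK] := col j.
  have : qtq T Q (phi (psi n)) (e j) @[n --> \oo] --> B (e j).
    apply: (@coord_cvg_flag _ _ K) => [n|i]; first exact: hK.
    have := Bw (e j) (e i); rewrite coord_inner.
    by rewrite (eq_cvg _ _ (_ : _ =1 (fun n => qtq T Q (phi (psi n)) (e j) i))) // => n;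
      rewrite coord_inner.
  move=> /cvg_l2P h; apply/cvg_l2P.
  rewrite (eq_cvg _ _ (_ : _ =1
    (fun n => l2norm (B (e j) - qtq T Q (phi (psi n)) (e j))))) // => n.
  by rewrite sub0r opprB.
Qed.

Section enumeration.
Variables (M : enat) (p : nat -> nat).
Hypotheses (JE : J = p @` below M)
  (p_inc : forall i j, below M j -> (i < j)%N -> (p i < p j)%N).

Lemma enum_inj i j : below M i -> below M j -> p i = p j -> i = j.
Proof.
move=> Mi Mj pij; case: (ltngtP i j) => // ij.
  by have := p_inc Mj ij; rewrite pij ltnn.
by have := p_inc Mi ij; rewrite pij ltnn.
Qed.

Lemma enum_ge j : below M j -> (j <= p j)%N.
Proof.
elim: j => // j IH Mj; apply: leq_ltn_trans (p_inc Mj (ltnSn j)).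
by apply: IH; apply: below_leq Mj.
Qed.

(** By injectivity of [p] at most one term has a nonzero coordinate [i]; the case distinction asks
    whether the partial sum already contains it. *)
Lemma enum_sum_coord n x i :
  (\sum_(j < n | (j : nat) \in below M)
     lv (p j) *: rank_one (e (p j)) (e (p j)) x : H) i =
  if pselect (exists2 j, (j < n)%N & below M j /\ p j = i) then limit_coef i * x i
  else 0.
Proof.
have term j l : (lv (p j) *: rank_one (e (p j)) (e (p j)) x : H) l =
    lv (p j) * (x (p j) * (l == p j)%:R).
  by rewrite l2Z /rank_one coord_inner l2Z basisE.
rewrite l2_sum; case: pselect => [h|nex]; rewrite [RHS]/=.
  have [j0 j0n [Mj0 <-]] := h.
  have Jp : p j0 \in J by apply: mem_set; rewrite JE; exists j0.
  rewrite (bigD1 (Ordinal j0n)); last exact: below_in.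
  rewrite term eqxx mulr1 /limit_coef Jp big1 ?Monoid.mulm1 //.
  move=> j /andP[/set_mem Mj jj0]; rewrite term (_ : (_ == _) = false) ?mulr0 //.
  apply/eqP => /(enum_inj Mj0 Mj) E; move/eqP: jj0; apply.
  by apply: val_inj.
rewrite big1 // => j /set_mem Mj; rewrite term (_ : (_ == _) = false) ?mulr0 //.
by apply/eqP => ij; apply: nex; exists j.
Qed.

(** Since [j <= p j], the term meeting a coordinate [i < n] has index at most [i] and is already in
    the [n]-th partial sum, as [l2_tail_cvg] requires. *)
Lemma limit_diag_op_sum : is_op_sum (below M)
  (fun j x => lv (p j) *: rank_one (e (p j)) (e (p j)) x) limit_diag.
Proof.
move=> x; apply: (@l2_tail_cvg _ _ _ (cl%:C *: x)) => n i.
  move=> ni; rewrite enum_sum_coord diag_opE; case: pselect => // nex.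
  rewrite /limit_coef; case: (boolP (i \in J)) => [/set_mem|_]; last by rewrite mul0r.
  rewrite JE => -[j Mj pj]; case: nex; exists j => //.
  by apply: leq_ltn_trans ni; rewrite -pj enum_ge.
rewrite enum_sum_coord diag_opE l2Z normcM normc_real ger0_norm //.
have h : normc (limit_coef i * x i) <= cl * normc (x i).
  by rewrite normcM ler_wpM2r ?Defs.normc_ge0 // limit_coef_le.
case: pselect => [?|?]; last by rewrite subr0.
by rewrite subrr [normc 0]normc0 mulr_ge0 // Defs.normc_ge0.
Qed.

Lemma limit_diag_finite M0 x : M = Some M0 ->
  limit_diag x = \sum_(j < M0) lv (p j) *: rank_one (e (p j)) (e (p j)) x.
Proof.
move=> ME; apply: l2_ext => i.
rewrite (eq_bigl (fun j : 'I_M0 => (j : nat) \in below M)); last first.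
  by move=> j; apply/esym/below_in; rewrite ME; exact: (ltn_ord j).
rewrite enum_sum_coord diag_opE; case: pselect => // nex.
rewrite /limit_coef; case: (boolP (i \in J)) => [/set_mem|_]; last by rewrite mul0r.
rewrite JE => -[j Mj pj]; case: nex; exists j => //.
by move: Mj; rewrite ME.
Qed.

(** The error depends only on the [M0] coordinates [p j] of [x], each at most 1 in modulus on the
    unit ball, so the constants of these columns add up. *)
Lemma section_uniform_rate M0 : M = Some M0 ->
  exists2 K : R, 0 <= K & \forall n \near \oo,
    forall x, l2norm x <= 1 -> l2norm (section_error n x) <= K * r ^+ n.
Proof.
move=> ME.
have Jp (j : 'I_M0) : J (p j).
  by rewrite JE; exists (j : nat) => //; rewrite ME; exact: (ltn_ord j).
have /choice[K hK] : forall j : 'I_M0, exists K : R, 0 <= K /\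
    \forall n \near \oo, l2norm (section_error n (e (p j))) <= K * r ^+ n.
  move=> j; have [K K0 hK] := rate (Jp j); exists K; split=> //.
  by apply: filterS hK => n; apply: le_trans; exact: section_error_basis_le.
exists (\sum_j K j); first by apply: sumr_ge0 => j _; exact: (hK j).1.
have : \forall n \near \oo, forall j : 'I_M0,
    l2norm (section_error n (e (p j))) <= K j * r ^+ n.
  by apply: filter_forall => j; exact: (hK j).2.
apply: filterS => n hn x x1.
have -> : section_error n x = \sum_(j < M0) x (p j) *: section_error n (e (p j)).
  have xE : coord_proj J x = \sum_(j < M0) x (p j) *: e (p j).
    apply: l2_ext => i; rewrite coord_projE l2_sum.
    case: (boolP (i \in J)) => [/set_mem|nJ].
      rewrite JE => -[j0 Mj0 <-]; have j0M : (j0 < M0)%N by move: Mj0; rewrite ME.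
      rewrite (bigD1 (Ordinal j0M)) // l2Z basisE eqxx mulr1.
      rewrite big1 ?Monoid.mulm1 // => j jj0.
      rewrite l2Z basisE (_ : (_ == _) = false) ?mulr0 //.
      apply/eqP => E; move/eqP: jj0; apply; apply: val_inj => /=.
      by apply/esym/(enum_inj Mj0 _ E); rewrite ME; exact: (ltn_ord j).
    rewrite big1 // => j _; rewrite l2Z basisE (_ : (_ == _) = false) ?mulr0 //.
    by apply/eqP => E; move/negP: nJ; apply; apply: mem_set; rewrite E.
  have -> : section_error n x = section_error n (coord_proj J x).
    rewrite !section_errorE; congr (coord_proj J (qtq _ _ _ _) - _).
      by apply: l2_ext => i; rewrite !coord_projE; case: ifP.
    apply: l2_ext => i; rewrite !diag_opE coord_projE /limit_coef.
    by case: ifP => //; rewrite !mul0r.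
  by rewrite xE linear_sum; apply: eq_bigr => j _; rewrite linearZ.
apply: le_trans (l2norm_sum _ _ _) _; rewrite mulr_suml; apply: ler_sum => j _.
rewrite l2normZ -[leRHS]mul1r; apply: ler_pM => //.
- exact: Defs.normc_ge0.
- exact: l2norm_ge0.
- exact: le_trans (normc_coord_le _ _) x1.
Qed.

End enumeration.
End diagonal_limit.
End limits.

(** * The constant r, the eigenvalues of the q^_j, and the final assembly *)

Lemma modulus_ratios (R : realType) (N : nat) (a : nat -> R) (rho : R) :
  let r := \big[Num.max/rho / a N.-1]_(i < N.-1) (a i.+1 / a i) in
  (0 < N)%N -> (forall i, (i.+1 < N)%N -> a i.+1 < a i) ->
  rho < a N.-1 -> 0 <= rho ->
  [/\ 0 <= r, r < 1, forall i, (i < N)%N -> 0 < a i,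
      forall k l, (k < l)%N -> (l < N)%N -> a l <= r * a k &
      forall k, (k < N)%N -> rho <= r * a k].
Proof.
move=> r N0 dec rholt rho0.
have anti i j : (i <= j)%N -> (j < N)%N -> a j <= a i.
  move=> /subnK <-; elim: (j - i)%N => // n IH; rewrite addSn => nN.
  by apply: le_trans (ltW (dec _ nN)) _; apply: IH; exact: ltnW.
have NN : (N.-1 < N)%N by rewrite prednK.
have aN : 0 < a N.-1 by exact: le_lt_trans rholt.
have a0 i : (i < N)%N -> 0 < a i.
  move=> iN; apply: lt_le_trans aN _; apply: anti => //.
  by rewrite -ltnS prednK.
have rid : rho / a N.-1 <= r by exact: bigmax_ge_id.
have r0 : 0 <= r by apply: le_trans rid; rewrite divr_ge0 // ltW.
have step i : (i.+1 < N)%N -> a i.+1 <= r * a i.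
  move=> iN; have iN1 : (i < N.-1)%N by rewrite -ltnS prednK.
  rewrite -ler_pdivrMr ?a0 //; last exact: ltnW.
  exact: (le_bigmax _ _ (Ordinal iN1)).
split=> //.
- apply/bigmax_ltP; split=> [|[i /= iN] _]; first by rewrite ltr_pdivrMr // mul1r.
  have iN' : (i.+1 < N)%N by rewrite -[N]prednK // ltnS.
  by rewrite ltr_pdivrMr ?mul1r ?dec // a0 // ltnW.
(* [r] bounds ratios of neighbours: the last step, from [l] to [l.+1], gains the factor [r], and
   monotonicity covers the way from [k] to [l]. *)
- move=> k [//|l] kl lN; apply: le_trans (step l lN) _; rewrite ler_wpM2l //.
  by apply: anti => //; exact: ltnW.
- move=> k kN; apply: le_trans (_ : r * a N.-1 <= _); first by rewrite -ler_pdivrMr.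
  by rewrite ler_wpM2l //; apply: anti => //; rewrite -ltnS prednK.
Qed.

(** [(z - l) *: v] is a difference of two defects of [Q_n^* T Q_n v]: that from [l *: v] tends to 0
    by hypothesis, that from [z *: v] because [Q_n v] approaches the line of the eigenvector [q]. *)
Lemma eigenvalue_of_limit (R : realType) (T : l2op R) (Q : nat -> l2op R)
    (q v : l2 R) (l z : R[i]) :
  bounded_op T -> (forall n, unitary_op (Q n)) ->
  l2norm q = 1 -> l2norm v = 1 -> T q = z *: q ->
  gap (lspan [set Q k v]) (lspan [set q]) @[k --> \oo] --> (0 : R) ->
  l2norm (qtq T Q n v - l *: v) @[n --> \oo] --> (0 : R) -> z = l.
Proof.
move=> bT uQ q1 v1 Tq hgap hl; have [c c0 hc] := bounded_opP bT.
have cz0 : 0 <= c + normc z by rewrite addr_ge0 ?Defs.normc_ge0.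
have hz n : normc (z - l) <= (c + normc z) * gap (lspan [set Q n v]) (lspan [set q]) +
    l2norm (qtq T Q n v - l *: v).
  have -> : normc (z - l) = l2norm ((z - l) *: v) by rewrite l2normZ v1 mulr1.
  have -> : (z - l) *: v = - (qtq T Q n v - z *: v) + (qtq T Q n v - l *: v).
    by rewrite scalerBl opprB addrA subrK.
  apply: le_trans (l2normD _ _) _; rewrite l2normN lerD2r.
  have [_ QK _] := uQ n.
  have -> : qtq T Q n v - z *: v = adj (Q n) (T (Q n v) - z *: Q n v).
    by rewrite [in RHS]linearB [adj _ (_ *: _)]linearZ /= QK.
  rewrite unitary_adj_l2norm //; set b := inner (Q n v) q.
  pose d := Q n v - b *: q.
  have -> : T (Q n v) - z *: Q n v = T d - z *: d.
    have -> : T d = T (Q n v) - z *: (b *: q).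
      by rewrite /d linearB [T (b *: _)]linearZ /= Tq !scalerA mulrC.
    by rewrite /d scalerBr opprB addrA subrK.
  apply: (@le_trans _ _ ((c + normc z) * l2norm d)).
    by rewrite mulrDl; apply: le_trans (l2normB _ _) _; rewrite lerD // l2normZ.
  by rewrite ler_wpM2l // gap_line_ge // unitary_l2norm.
have h0 : (fun _ : nat => normc (z - l)) n @[n --> \oo] --> (0 : R).
  apply: (cvg0_le _ hz) => [n|]; first exact: Defs.normc_ge0.
  rewrite -[X in _ --> X]addr0; apply: cvgD => //.
  by rewrite -(mulr0 (c + normc z)); apply: cvgM => //; exact: cvg_cst.
have h1 : (fun _ : nat => normc (z - l)) n @[n --> \oo] --> normc (z - l).
  exact: cvg_cst.
apply/eqP; rewrite -subr_eq0 -normc_eq0; apply/eqP.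
exact: (cvg_unique (@norm_hausdorff _ R^o) h1 h0).
Qed.

Theorem theorem3p9 (R : realType) (T : l2op R)
    (N : nat) (lam : nat -> R[i]) (m : nat -> enat) (Psi : set R[i])
    (P : l2op R) (Q Rs : nat -> l2op R) (p : nat -> nat) (q : nat -> l2 R) :
  let e := @l2_basis R in
  let omega := [set lam i | i in [set i | (i < N)%N]] in
  let M := \big[enat_add/Some 0%N]_(i < N) m i in
  let rho := sup [set normc z | z in Psi] in
  let r := \big[Num.max/rho / normc (lam N.-1)]_(i < N.-1)
             normc (lam i.+1 / lam i) in
  let Theta := [set j | ~ (p @` below M) j] in
  let PM := orthoproj (closure (lspan [set e (p j) | j in below M])) in
  let QTQ n x := adj (Q n) (T (Q n x)) in
  bounded_op T -> invertible_op T -> normal_op T ->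
  (0 < N)%N ->
  spectrum T = omega `|` Psi ->
  (forall i, (i < N)%N ->
    [/\ eigenvalue_op T (lam i), isolated (spectrum T) (lam i) &
        has_dim (eigenspace_op T (lam i)) (m i)]) ->
  (forall i, (i.+1 < N)%N -> normc (lam i.+1) < normc (lam i)) ->
  rho < normc (lam N.-1) ->
  is_spectral_proj T omega P ->
  QR_sequences T Q Rs ->
  hat_enum P M p ->
  hat_eigenvectors T P Q M p q ->
  exists D : l2op R,
    [/\ bounded_op D /\
        is_op_sum (below M) (fun j x =>
          inner (T (q j)) (q j) *: rank_one (e (p j)) (e (p j)) x) D,
        (* (i) *)
        forall phi : nat -> nat, {homo phi : i j / (i < j)%N} ->
          exists psi : nat -> nat, {homo psi : i j / (i < j)%N} /\
          exists (xi : nat -> l2 R) (S : l2op R),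
            [/\ forall j, Theta j -> closure (lspan [set e i | i in Theta]) (xi j),
                bounded_op S /\
                is_op_sum Theta (fun j => rank_one (xi j) (e j)) S,
                wot_cvg (fun k => QTQ (phi (psi k))) (fun x => D x + S x) &
                column_finite T ->
                  sot_cvg (fun k => QTQ (phi (psi k))) (fun x => D x + S x)],
        (* (ii) *)
        [/\ sot_cvg (fun n x => PM (QTQ n (PM x))) D,
            r < 1 &
            forall x, lspan [set e (p j) | j in below M] x ->
              (fun n => l2norm (PM (QTQ n (PM x)) - D x)) =O_\oo
                (fun n => r ^+ n)],
        (* M finite *)
        forall M0 : nat, M = Some M0 ->
          let d i := odflt 0%N (m i) in
          (exists s : 'S_M0, forall x,
            D x = \sum_(k < N) lam k *:
              \sum_(j < M0 | (\sum_(l < k) d l <= j < \sum_(l < k.+1) d l)%N)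
                rank_one (e (p (s j))) (e (p (s j))) x) /\
          (fun n => opnorm (fun x => PM (QTQ n (PM x)) - D x)) =O_\oo
            (fun n => r ^+ n) &
        (* linearly independent chi_omega(T) e_l *)
        lin_indep (below M) (fun l => P (e l)) ->
          forall j, below M j -> p j = j].
Proof.
move=> e omega M rho r Theta PM QTQ bT iT _ N0 specE hlam dec rholt.
move=> [Phi [calc PE]] qr henum [_ ort qeig qgap _].
have [c c0 hc] := bounded_opP bT.
have specb z : spectrum T z -> normc z <= c by exact: spectrum_bounded.
have Psib z : Psi z -> normc z <= c by move=> Pz; apply: specb; rewrite specE; right.
have rho_ub z : Psi z -> normc z <= rho.
  by move=> Pz; apply: ub_le_sup; [exists c => _ [w Pw <-]; exact: Psib|exists z].
have rho0 : 0 <= rho.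
  have [[z Pz]|nP] := pselect (Psi !=set0).
    by apply: le_trans (rho_ub z Pz); exact: Defs.normc_ge0.
  (* [Psi] may be empty; the supremum of the empty set is 0 by convention. *)
  rewrite /rho (_ : Psi = set0) ?image_set0 ?sup0 //.
  by apply/seteqP; split=> // z Pz; apply: nP; exists z.
have rE : r = \big[Num.max/rho / normc (lam N.-1)]_(i < N.-1)
    (normc (lam i.+1) / normc (lam i)).
  by apply: eq_bigr => i _; rewrite normcM normcV.
have [r0 r1 lam_pos lam_ratio rho_ratio] :=
  modulus_ratios (a := fun i => normc (lam i)) N0 dec rholt rho0.
rewrite -rE in r0 r1 lam_ratio rho_ratio.
have lam_lt k l : (k < l)%N -> (l < N)%N -> normc (lam l) < normc (lam k).
  move=> kl lN; apply: le_lt_trans (lam_ratio k l kl lN) _.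
  by rewrite gtr_pMl // lam_pos // (ltn_trans kl).
have lam_inj i j : (i < N)%N -> (j < N)%N -> lam i = lam j -> i = j.
  move=> iN jN lij; case: (ltngtP i j) => // ij.
    by have := lam_lt _ _ ij jN; rewrite lij ltxx.
  by have := lam_lt _ _ ij iN; rewrite lij ltxx.
have lam_gap k z : (k < N)%N -> spectrum T z ->
    (forall i, (i <= k)%N -> z <> lam i) -> normc z <= r * normc (lam k).
  move=> kN; rewrite specE => -[[l /= lN <-] nz|Pz _].
    apply: lam_ratio => //; rewrite ltnNge; apply/negP => lk.
    exact: (nz l lk).
  by apply: le_trans (rho_ub z Pz) _; exact: rho_ratio.
pose E := eigenproj Phi lam.
have E_orth k l x : (k < N)%N -> (l < N)%N -> k != l -> E k (E l x) = 0.
  exact: (eigenproj_orth calc lam_inj).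
have E_sa k x y : inner (E k x) y = inner x (E k y).
  exact: (eigenproj_self_adjoint calc).
have lam0 l : (l < N)%N -> lam l != 0.
  by move=> lN; rewrite -normc_eq0 gt_eqF // lam_pos.
have [f fP] := adapted_basis_exists N E.
have [uQ TQR Rs_flag Rs_inj] := QR_structure iT qr.
pose J := p @` below M.
have Jlevel i : J i -> ((f i).2 < N)%N.
  case: (henum) => K [_ _ pE]; rewrite /J pE => -[Li nLi].
  have [_ _ kN _ _] := fP i; rewrite ltn_neqAle kN andbT; apply/eqP => ki.
  apply: nLi; split=> //.
  apply: (adapted_top_dep fP (P := P)) => // x hx; rewrite PE.
  exact: (proj_omega_eq0 calc lam_inj).
have TE l x : (l < N)%N -> T (E l x) = lam l *: E l x.
  by move=> _; exact: (eigenproj_eigen bT calc).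
have ET l x : (l < N)%N -> E l (T x) = lam l *: E l x.
  by move=> _; exact: (eigenproj_comm bT calc).
have lead l x n : (l < N)%N -> (forall l', (l' < l)%N -> E l' x = 0) ->
    l2norm (iter n T x - lam l ^+ n *: E l x) <=
      (r * normc (lam l)) ^+ n * l2norm x.
  exact: (iter_leading bT calc lam_inj lam_gap r0).
(* The eigenvalue read off from the elimination; [Tq] identifies it with that of [q j]. *)
pose lv i := lam (f i).2.
have rate i : J i -> exists2 K : R, 0 <= K &
    \forall n \near \oo, l2norm (qtq T Q n (e i) - lv i *: e i) <= K * r ^+ n.
  move=> /Jlevel ki.
  exact: (qtq_basis_rate E_orth E_sa fP uQ TQR Rs_flag Rs_inj r0 r1 lam0 TE ET lead bT ki).
have row i x : J i ->
    inner (qtq T Q n x) (e i) @[n --> \oo] --> lv i * inner x (e i).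
  move=> /Jlevel ki.
  exact: (qtq_row_cvg E_orth E_sa fP uQ TQR Rs_flag Rs_inj r0 r1 lam0 ET lead bT ki).
have cl0 : 0 <= normc (lam 0) by exact: Defs.normc_ge0.
have lv_le i : J i -> normc (lv i) <= normc (lam 0).
  move=> /Jlevel; rewrite /lv; case: (f i).2 => // k kN.
  by apply: ltW; exact: lam_lt.
pose D := limit_diag cl0 lv_le.
have p_inc i j : below M j -> (i < j)%N -> (p i < p j)%N.
  by case: (henum) => K [_ h _]; exact: h.
have JE : J = p @` below M by [].
have spanE : [set e (p j) | j in below M] = [set e i | i in J].
  by rewrite /J image_comp.
have PME x : PM x = coord_proj J x by rewrite /PM spanE orthoproj_basis.
have errE n x : PM (QTQ n (PM x)) - D x = section_error T Q cl0 lv_le n x.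
  by rewrite section_errorE !PME.
have q1 j : below M j -> l2norm (q j) = 1.
  move=> Mj; apply/eqP; rewrite -(@eqrXn2 _ 2) ?l2norm_ge0 // expr1n.
  by apply/eqP/(@complexI R); rewrite -inner_diag ort // eqxx.
have Tq j : below M j -> T (q j) = lv (p j) *: q j.
  move=> Mj; have [z hz] := qeig j Mj; rewrite hz; congr (_ *: _).
  have Jpj : J (p j) by exists j.
  have [K K0 hK] := rate _ Jpj.
  apply: (eigenvalue_of_limit bT uQ (q1 j Mj) (l2norm_basis R (p j)) hz (qgap j Mj)).
  by apply: (cvg_le_expr r0 r1 _ hK) => n; exact: l2norm_ge0.
have mu j : below M j -> inner (T (q j)) (q j) = lv (p j).
  by move=> Mj; rewrite Tq // innerZl ort // eqxx mulr1.
exists D; split.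
- split; first exact: limit_diag_bounded.
  have sumD : is_op_sum (below M)
      (fun j x => lv (p j) *: rank_one (e (p j)) (e (p j)) x) D.
    exact: limit_diag_op_sum JE p_inc.
  move=> x; have := sumD x.
  rewrite (eq_cvg _ _ (_ : _ =1 (fun n => \sum_(j < n | (j : nat) \in below M)
    inner (T (q j)) (q j) *: rank_one (e (p j)) (e (p j)) x))) // => n.
  by apply: eq_bigr => j /set_mem Mj; rewrite mu.
- move=> phi phi_mono.
  have [psi [psi_mono [xi [S [h1 h2 h3 h4]]]]] :=
    weak_limit bT uQ r0 r1 cl0 lv_le rate row phi_mono.
  exists psi; split=> //; exists xi, S; split=> // cT; apply: h4 => j.
  exact: (qtq_flag iT qr).
- split=> //.
    rewrite (_ : (fun n x => PM (QTQ n (PM x))) =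
      (fun n x => coord_proj J (qtq T Q n (coord_proj J x)))).
      exact: (section_sot_cvg bT uQ r0 r1 rate).
    by apply/funext => n; apply/funext => x; rewrite !PME.
  move=> x; rewrite spanE => Jx.
  have [K K0 hK] := section_rate cl0 lv_le rate Jx.
  apply: (expr_bound_eqO r0 K0) => [n|]; first exact: l2norm_ge0.
  by apply: filterS hK => n; rewrite errE.
- move=> M0 ME d; have [md dsum] := enat_sum_Some ME; split; last first.
    have [K K0 hK] := section_uniform_rate cl0 lv_le rate JE p_inc ME.
    have err_le n (x : l2 R) (B : R) : l2norm (section_error T Q cl0 lv_le n x) <= B ->
        l2norm (PM (QTQ n (PM x)) - D x) <= B by rewrite errE.
    apply: (expr_bound_eqO r0 K0) => [n|].
      (* Non-negativity of the operator norm is read off at [x = 0], once the supremum is known to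
         be finite. *)
      have [c' c'0 hc'] := qtq_bound bT uQ.
      have B0 : l2norm (PM (QTQ n (PM 0)) - D 0) <=
          opnorm (fun x => PM (QTQ n (PM x)) - D x).
        apply: (@opnorm_ge _ (fun x => PM (QTQ n (PM x)) - D x)
          (c' + normc (lam 0)) 0); last by rewrite l2norm0.
        move=> x x1; rewrite !PME; apply: le_trans (l2normB _ _) _; apply: lerD.
          apply: le_trans (coord_proj_le _ _) _; apply: le_trans (hc' n _) _.
          rewrite -[leRHS]mulr1 ler_wpM2l //; apply: le_trans x1.
          exact: coord_proj_le.
        apply: le_trans (diag_op_le _ _ _) _.
        by rewrite -[leRHS]mulr1 ler_wpM2l.
      by apply: le_trans B0; exact: l2norm_ge0.
    apply: filterS hK => n hn; apply: opnorm_le => x x1.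
    by apply: err_le; exact: hn.
  pose kappa (j : 'I_M0) := (f (p j)).2.
  have Mj (j : 'I_M0) : below M j by rewrite ME; exact: (ltn_ord j).
  have kN (j : 'I_M0) : (kappa j < N)%N by apply: Jlevel; exists (j : nat).
  (* The [q j] whose index has level [k] are orthonormal vectors of an eigenspace of dimension
     [d k]. *)
  have card_le k : (k < N)%N -> (#|[pred j | kappa j == k]| <= d k)%N.
    move=> kN'; apply: (@orthonormal_card_le _ _ _ q (eigenspace_op T (lam k))).
    - by move=> i j iM jM; apply: ort; rewrite ME.
    - move=> j /eqP jk; rewrite /eigenspace_op /mkset Tq //.
      by rewrite /lv -[(f (p j)).2]/(kappa j) jk.
    - by have [_ _] := hlam k kN'; rewrite md.
  have [s hs] := block_perm kN dsum card_le.
  have DE x : D x = \sum_(j < M0) lv (p j) *: rank_one (e (p j)) (e (p j)) x.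
    exact: (limit_diag_finite cl0 lv_le JE p_inc).
  exists s => x; rewrite DE.
  (* After renumbering by [s] the double sum is exchanged; by [hs] each [j] lies in exactly one
     block, that of its level. *)
  rewrite (reindex_inj (@perm_inj _ s)) /=.
  under [RHS]eq_bigr => k _ do rewrite scaler_sumr.
  rewrite (exchange_big_dep predT) //=; apply: eq_bigr => j _.
  rewrite (bigD1 (Ordinal (kN (s j)))) /=; last by rewrite -hs.
  rewrite big1 ?addr0 // => k /andP[]; rewrite -hs // => /eqP sk /eqP kk.
  by case: kk; apply: val_inj; rewrite /= sk.
- exact: hat_enum_lin_indep henum.
Qed.
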